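(* Let $\mathcal{B}$ be a semi-normalized $M$-bounded basis of a quasi-Banach space $\mathbb{X}$. Then $\mathcal{B}$ is quasi-greedy if and only if $\mathcal{B}$ is quasi-greedy for largest coefficients (QGLC) and the truncation operators $(\mathcal{T}_m)_{m=0}^\infty$ are uniformly bounded. Moreover, if $\mathbb{X}$ is a $p$-Banach space ($0<p\le1$), then $$\Lambda_t\le C_{qg}\left(1+C_{qg}^p\,\eta_p^p(C_{qg})\right)^{1/p}\quad\text{and}\quad C_{qg}\le2^{1/p}C_{ql}\Lambda_t.$$
   Context: The scalar field is $\mathbb{R}$ or $\mathbb{C}$. A quasi-norm satisfies the axioms of a norm except that the triangle inequality is replaced by $\Vert f+g\Vert\le\kappa(\Vert f\Vert+\Vert g\Vert)$ for some constant $\kappa\ge1$; a quasi-Banach space is a vector space complete for the topology of a quasi-norm. It is a $p$-Banach space if moreover $\Vert f+g\Vert^p\le\Vert f\Vert^p+\Vert g\Vert^p$ for all $f,g$. A basis of $\mathbb{X}$ is a sequence $\mathcal{B}=(\mathbf{x}_n)_{n=1}^\infty$ whose closed linear span is $\mathbb{X}$ and for which there is a (unique) sequence $(\mathbf{x}_n^* )_{n=1}^\infty$ in $\mathbb{X}^*$ with $\mathbf{x}_n^*(\mathbf{x}_k)=\delta_{k,n}$. It is $M$-bounded if $\sup_n\Vert\mathbf{x}_n\Vert\,\Vert\mathbf{x}_n^*\Vert<\infty$ and semi-normalized if $0<\inf_n\Vert\mathbf{x}_n\Vert\le\sup_n\Vert\mathbf{x}_n\Vert<\infty$. The support of $f$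 is $\mathrm{supp}(f)=\{n:\mathbf{x}_n^*(f)\ne0\}$. For finite $A\subseteq\mathbb{N}$, $S_A(f)=\sum_{n\in A}\mathbf{x}_n^*(f)\mathbf{x}_n$ and $S_{A^c}(f)=f-S_A(f)$. A set $A\subseteq\mathbb{N}$ is a greedy set of $f$ if $|\mathbf{x}_k^*(f)|\le|\mathbf{x}_n^*(f)|$ for all $n\in A$, $k\in\mathbb{N}\setminus A$ (an infinite $A$ is a greedy set of $f$ iff $\mathrm{supp}(f)\subseteq A$). For $m\ge0$, the $m$th greedy set $A_m(f)$ is the unique $A\subseteq\mathbb{N}$ with $|A|=m$ such that for all $n\in A$, $k\notin A$, either $|\mathbf{x}_n^*(f)|>|\mathbf{x}_k^*(f)|$, or equality holds and $n<k$. $\mathcal{B}$ is quasi-greedy if there is $C<\infty$ with $\Vert S_A(f)\Vert\le C\Vert f\Vert$ for all $f$ and all finite greedy sets $A$ of $f$; $C_{qg}$ is then the smallest $C$ such that $\Vert S_{A\setminus B}(f)\Vert\le C\Vert f\Vert$ for all $f$ and all finite greedy sets $B\subseteq A$ of $f$. For finite $A$ and $\varepsilon=(\varepsilon_n)_{n\in A}$ scalars of modulus one, $\mathbf{1}_{\varepsilon,A}=\sum_{n\in A}\varepsilon_n\mathbf{x}_n$. $\mathcal{B}$ is QGLC if there is $C$ such that $\Vert\mathbf{1}_{\varepsilon,A}\Vert\le C\Vert f+\mathbf{1}_{\varepsilon,A}\Vert$ for all finite $A\subseteq\mathbb{N}$, all such $\varepsilon$, and all $f\in\mathbb{X}$ with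 $\mathrm{supp}(f)\cap A=\emptyset$ and $|\mathbf{x}_n^*(f)|\le1$ for all $n\in\mathbb{N}$. In this case $C_{ql}$ is the smallest $C$ such that $\max\{\Vert f\Vert,\Vert\mathbf{1}_{\varepsilon,A}\Vert\}\le C\Vert f+\mathbf{1}_{\varepsilon,A}\Vert$ under the same conditions. Let $\mathrm{sign}(0)=1$ and $\mathrm{sign}(a)=a/|a|$ for $a\ne0$. For finite $A$, $\mathcal{U}(f,A)=\min_{n\in A}|\mathbf{x}_n^*(f)|\sum_{n\in A}\mathrm{sign}(\mathbf{x}_n^*(f))\mathbf{x}_n$ (zero if $A=\emptyset$) and $\mathcal{T}(f,A)=\mathcal{U}(f,A)+S_{A^c}(f)$; if $A$ is infinite with $\mathrm{supp}(f)\subseteq A$, $\mathcal{T}(f,A)=0$. The $m$th truncation operator is $\mathcal{T}_m(f)=\mathcal{T}(f,A_m(f))$; uniformly bounded means $\sup_m\sup_{\Vert f\Vert\le1}\Vert\mathcal{T}_m(f)\Vert<\infty$. Further $\Lambda_t=\sup\{\Vert\mathcal{T}(f,A)\Vert:A\text{ greedy set of }f,\ \Vert f\Vert\le1\}$. Finally $A_p=(2^p-1)^{-1/p}$ and $\eta_p(u)=\min_{0<t<1}(1-t^p)^{-1/p}\left(1-(1+A_p^{-1}u^{-1}t)^{-p}\right)^{-1/p}$ for $u>0$. *)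

(* Defs.v *)
From mathcomp Require Import all_boot all_order all_algebra.
From mathcomp Require Import complex.
From mathcomp Require Import all_classical all_reals all_analysis.

Set Implicit Arguments.
Unset Strict Implicit.
Unset Printing Implicit Defensive.

Import Order.TTheory GRing.Theory Num.Theory.
Import numFieldNormedType.Exports.

Local Open Scope classical_set_scope.
Local Open Scope ring_scope.

Inductive scalar_kind : Set := RealScalars | ComplexScalars.

Definition scalars (R : realType) (k : scalar_kind) : numFieldType :=
  match k with RealScalars => R | ComplexScalars => R[i] end.

(* The norm of [R[i]] takes its values in [R[i]]; [modulus] is its real-valued
   counterpart, and [of_real] is the inclusion of the reals. *)
Definition modulus (R : realType) (k : scalar_kind) : scalars R k -> R :=
  match k with
  | RealScalars => fun a : R => `|a|
  | ComplexScalars => fun a : R[i] => complex.Re `|a|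
  end.

Definition of_real (R : realType) (k : scalar_kind) : R -> scalars R k :=
  match k with
  | RealScalars => fun r : R => r
  | ComplexScalars => fun r : R => real_complex R r
  end.

Definition sign (R : realType) (k : scalar_kind) (a : scalars R k) :
  scalars R k := if a == 0 then 1 else a / `|a|.

Section QuasiBanach.
Context (R : realType) (k : scalar_kind) (X : lmodType (scalars R k)).
Variable qn : X -> R.

Definition is_quasi_norm : Prop :=
  [/\ forall f, 0 <= qn f,
      forall f, qn f = 0 -> f = 0,
      forall (a : scalars R k) f, qn (a *: f) = modulus a * qn f
    & exists2 kappa : R, 1 <= kappa &
        forall f g, qn (f + g) <= kappa * (qn f + qn g)].

(* Balls form a countable base of neighbourhoods of 0, so completeness can be
   tested on sequences. *)
Definition qn_complete : Prop :=
  forall u : nat -> X,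
    (forall e : R, 0 < e -> exists N : nat, forall m n : nat,
       (N <= m)%N -> (N <= n)%N -> qn (u m - u n) < e) ->
    exists l : X, qn (u n - l) @[n --> \oo] --> (0 : R).

Definition quasi_Banach : Prop := is_quasi_norm /\ qn_complete.

Definition p_Banach (p : R) : Prop :=
  quasi_Banach /\ forall f g, qn (f + g) `^ p <= qn f `^ p + qn g `^ p.

Definition qn_continuous (phi : X -> scalars R k) : Prop :=
  forall f (e : R), 0 < e -> exists2 d : R, 0 < d &
    forall g, qn (g - f) < d -> modulus (phi g - phi f) < e.

Local Open Scope ereal_scope.
Definition dual_norm (phi : X -> scalars R k) : \bar R :=
  ereal_sup [set (modulus (phi f))%:E | f in [set f | (qn f <= 1)%R]].
Local Close Scope ereal_scope.

(* Sequences are indexed from 0. *)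
Variables (x : nat -> X) (xs : nat -> {scalar X}).

Definition linear_span : set X :=
  [set g | exists (n : nat) (c : nat -> scalars R k),
             g = \sum_(i < n) c i *: x i].

(* [xs] is the sequence of coordinate functionals of [x], which is unique. *)
Definition is_basis : Prop :=
  [/\ forall f (e : R), 0 < e -> exists2 g, linear_span g & qn (f - g) < e,
      forall n, qn_continuous (xs n)
    & forall n j, xs n (x j) = (n == j)%:R].

Definition M_bounded : Prop :=
  (ereal_sup [set (qn (x n))%:E * dual_norm (xs n) | n in [set: nat]]
     < +oo)%E.

Definition semi_normalized : Prop :=
  (0 < ereal_inf [set (qn (x n))%:E | n in [set: nat]])%E /\
  (ereal_sup [set (qn (x n))%:E | n in [set: nat]] < +oo)%E.

Definition supp (f : X) : set nat := [set n | xs n f != 0].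

(* Meant for finite [A]; [\sum_(n \in A)] is then the plain finite sum. *)
Definition proj (A : set nat) (f : X) : X := \sum_(n \in A) xs n f *: x n.

Definition greedy_set (f : X) (A : set nat) : Prop :=
  forall n j, A n -> ~ A j -> modulus (xs j f) <= modulus (xs n f).

Definition is_mth_greedy_set (f : X) (m : nat) (A : set nat) : Prop :=
  (A #= `I_m)%card /\
  forall n j, A n -> ~ A j ->
    modulus (xs j f) < modulus (xs n f) \/
    (modulus (xs n f) = modulus (xs j f) /\ (n < j)%N).

Definition mth_greedy_set (f : X) (m : nat) : set nat :=
  xget set0 [set A | is_mth_greedy_set f m A].

Definition quasi_greedy : Prop :=
  exists C : R, forall f A, finite_set A -> greedy_set f A ->
    qn (proj A f) <= C * qn f.

(* The constants below are infima in [\bar R], hence +oo when no admissible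
   bound exists. *)
Definition C_qg : \bar R :=
  ereal_inf [set C%:E | C in [set C : R |
    forall f A B, finite_set A -> greedy_set f A -> greedy_set f B ->
      B `<=` A -> qn (proj (A `\` B) f) <= C * qn f]].

Definition ind (eps : nat -> scalars R k) (A : set nat) : X :=
  \sum_(n \in A) eps n *: x n.

Definition QGLC_pair (eps : nat -> scalars R k) (A : set nat) (f : X) : Prop :=
  [/\ finite_set A,
      forall n, A n -> modulus (eps n) = 1,
      supp f `&` A = set0
    & forall n, modulus (xs n f) <= 1].

Definition QGLC : Prop :=
  exists C : R, forall eps A f, QGLC_pair eps A f ->
    qn (ind eps A) <= C * qn (f + ind eps A).

Definition C_ql : \bar R :=
  ereal_inf [set C%:E | C in [set C : R |
    forall eps A f, QGLC_pair eps A f ->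
      Num.max (qn f) (qn (ind eps A)) <= C * qn (f + ind eps A)]].

(* For finite nonempty [A] the infimum is a minimum; for empty [A] the value
   is 0. *)
Definition restricted_trunc (f : X) (A : set nat) : X :=
  of_real k (inf [set modulus (xs n f) | n in A]) *:
    \sum_(n \in A) sign (xs n f) *: x n.

(* An infinite greedy set of [f] contains the support of [f]. *)
Definition trunc (f : X) (A : set nat) : X :=
  if `[< finite_set A >] then restricted_trunc f A + (f - proj A f) else 0.

Definition mth_trunc (m : nat) (f : X) : X := trunc f (mth_greedy_set f m).

Definition mth_trunc_uniformly_bounded : Prop :=
  (ereal_sup [set ereal_sup [set (qn (mth_trunc m f))%:E | f in
                               [set f | (qn f <= 1)%R]] | m in [set: nat]]
     < +oo)%E.

Definition Lambda_t : \bar R :=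
  ereal_sup [set y | exists f A,
    [/\ qn f <= 1, greedy_set f A & y = (qn (trunc f A))%:E]].

End QuasiBanach.

Definition A_const (R : realType) (p : R) : R := (2 `^ p - 1) `^ (- p^-1).

(* The function of [t] tends to +oo at 0 and at 1, so the infimum is attained
   (for [0 < p] and [0 < u]). *)
Definition eta (R : realType) (p u : R) : R :=
  inf [set (1 - t `^ p) `^ (- p^-1) *
           (1 - (1 + (A_const p)^-1 * u^-1 * t) `^ (- p)) `^ (- p^-1)
       | t in [set t : R | 0 < t < 1]].

(* Main.v *)
(** From quasi-greedy to truncations: let [A] be a greedy set of [f] with least
    modulus 1, and let [u] be its sign sum. Dividing each coefficient on [A] by
    the largest power of some [lam > 1] below its modulus turns [f] into a vector
    [h] which is a geometric series of greedy pieces of [f] and whose moduli lie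
    in [[1, lam)]. The multipliers of [h - u] lie in [[0, lam - 1)]; by binary
    expansion they produce at most a small multiple of [u], because every partial
    sum of [u] is a greedy projection of [u]. Optimizing [lam] gives [eta]. For a
    general quasi-norm, the triangle inequality is replaced by subadditivity, up
    to a constant, of a small power of it (Aoki--Rolewicz).

    Conversely, the truncation on a greedy set [A] is the sum of a flat vector
    on [A] and of [f - proj A f], whose coefficients are no larger, so QGLC
    bounds [f - proj A f] by the truncation; [proj (A `\` B) f] is a difference
    of two such vectors. *)
Require Import Defs.
From mathcomp Require Import all_boot all_order all_algebra.
From mathcomp Require Import finmap complex ring lra.
From mathcomp Require Import all_classical all_reals all_analysis.
Import Order.TTheory GRing.Theory Num.Theory.
Import numFieldNormedType.Exports.
Local Open Scope classical_set_scope.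
Local Open Scope ring_scope.

Set Implicit Arguments.
Unset Strict Implicit.
Unset Printing Implicit Defensive.

(** * Real moduli and signs, uniformly over the real and complex fields *)

Section Scalars.
Context {R : realType} {k : scalar_kind}.
Implicit Types (a b : scalars R k) (r s : R).

Lemma of_realD r s : of_real k (r + s) = of_real k r + of_real k s.
Proof. by case: k => //=; rewrite rmorphD. Qed.

Lemma of_realM r s : of_real k (r * s) = of_real k r * of_real k s.
Proof. by case: k => //=; rewrite rmorphM. Qed.

Lemma of_real1 : of_real k 1 = 1 :> scalars R k.
Proof. by case: k. Qed.

Lemma of_real0 : of_real k 0 = 0 :> scalars R k.
Proof. by case: k. Qed.

Lemma of_realN r : of_real k (- r) = - of_real k r.
Proof. by case: k => //=; rewrite rmorphN. Qed.

Lemma of_real_le r s : (of_real k r <= of_real k s) = (r <= s).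
Proof. by case: k => //=; rewrite lecR. Qed.

Lemma of_real_modulus a : of_real k (modulus a) = `|a|.
Proof. by move: a; case: k => //= a; rewrite RRe_real ?normr_real. Qed.

Lemma of_real_inj : injective (@of_real R k).
Proof. by case: k => // r s /complexI. Qed.

Lemma of_real_eq0 r : (of_real k r == 0) = (r == 0).
Proof. by rewrite -[0 in LHS]of_real0 (inj_eq of_real_inj). Qed.

Lemma modulus_ge0 a : 0 <= modulus a.
Proof. by rewrite -of_real_le of_real_modulus of_real0. Qed.

Lemma modulusM a b : modulus (a * b) = modulus a * modulus b.
Proof. by apply: of_real_inj; rewrite of_realM !of_real_modulus normrM. Qed.

Lemma modulusD a b : modulus (a + b) <= modulus a + modulus b.
Proof. by rewrite -of_real_le of_realD !of_real_modulus ler_normD. Qed.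

Lemma modulusN a : modulus (- a) = modulus a.
Proof. by apply: of_real_inj; rewrite !of_real_modulus normrN. Qed.

Lemma modulus_eq0 a : (modulus a == 0) = (a == 0).
Proof. by rewrite -of_real_eq0 of_real_modulus normr_eq0. Qed.

Lemma modulus0 : modulus (0 : scalars R k) = 0.
Proof. by apply/eqP; rewrite modulus_eq0. Qed.

Lemma modulus1 : modulus (1 : scalars R k) = 1.
Proof. by apply: of_real_inj; rewrite of_real_modulus normr1 of_real1. Qed.

Lemma modulus_of_real r : 0 <= r -> modulus (of_real k r) = r.
Proof.
move=> r0; apply: of_real_inj; rewrite of_real_modulus ger0_norm //.
by rewrite -of_real0 of_real_le.
Qed.

Lemma modulus_sign a : modulus (sign a) = 1.
Proof.
rewrite /sign; case: eqVneq => a0; first exact: modulus1.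
apply: of_real_inj; rewrite of_real_modulus of_real1.
by rewrite normrM normfV normr_id divff // normr_eq0.
Qed.

Lemma sign_neq0 a : sign a != 0.
Proof. by rewrite -modulus_eq0 modulus_sign oner_eq0. Qed.

Lemma sign_id a : sign (sign a) = sign a.
Proof.
rewrite {1}/sign (negbTE (sign_neq0 a)).
by rewrite -of_real_modulus modulus_sign of_real1 divr1.
Qed.

Lemma modulus_mul_sign a : of_real k (modulus a) * sign a = a.
Proof.
rewrite of_real_modulus /sign; case: eqVneq => [->|a0]; first by rewrite normr0 mul0r.
by rewrite mulrC divfK // normr_eq0.
Qed.

Lemma sign_real_mul r a : 0 < r -> sign (of_real k r * a) = sign a.
Proof.
move=> r0; rewrite /sign mulf_eq0 of_real_eq0 gt_eqF //=.
case: eqVneq => // a0; rewrite normrM -(of_real_modulus (of_real k r)).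
rewrite modulus_of_real ?ltW // -mulf_div divff ?mul1r //.
by rewrite of_real_eq0 gt_eqF.
Qed.

Lemma modulus_subr_ge a b : modulus a - modulus b <= modulus (a - b).
Proof. by rewrite lerBlDr -{1}(subrK b a) modulusD. Qed.

End Scalars.

(** * Quasi-norms *)

Lemma powR_monotone (R : realType) (p a b : R) : 0 < p -> 0 <= a -> a <= b ->
  a `^ p <= b `^ p.
Proof.
move=> p0 a0 ab; have b0 := le_trans a0 ab.
by rewrite ge0_ler_powR ?nnegrE // ltW.
Qed.

Lemma powRK (R : realType) (p a : R) : p != 0 -> 0 <= a -> (a `^ p) `^ p^-1 = a.
Proof. by move=> p0 a0; rewrite -powRrM divff // powRr1. Qed.

Lemma powRVK (R : realType) (p a : R) : p != 0 -> 0 <= a -> (a `^ p^-1) `^ p = a.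
Proof. by move=> p0 a0; rewrite -powRrM mulVf // powRr1. Qed.

Lemma powR_le_inj (R : realType) (p a b : R) : 0 < p -> 0 <= a -> 0 <= b ->
  a `^ p <= b `^ p -> a <= b.
Proof.
move=> p0 a0 b0 ab; have pn0 := lt0r_neq0 p0.
rewrite -(powRK pn0 a0) -(powRK pn0 b0).
by apply: powR_monotone; rewrite ?invr_gt0 ?powR_ge0.
Qed.

Lemma powR_lt1 (R : realType) (p a : R) : 0 < p -> 0 <= a -> a < 1 -> a `^ p < 1.
Proof.
move=> p0 a0 a1; have : a `^ p < 1 `^ p by apply: gt0_ltr_powR; rewrite ?nnegrE.
by rewrite powR1.
Qed.

Lemma powR_gt1 (R : realType) (p a : R) : 0 < p -> 1 < a -> 1 < a `^ p.
Proof.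
move=> p0 a1; have : 1 `^ p < a `^ p.
  by apply: gt0_ltr_powR; rewrite ?nnegrE // (le_trans ler01) // ltW.
by rewrite powR1.
Qed.

Lemma powRV (R : realType) (p a : R) : 0 <= a -> a^-1 `^ p = (a `^ p)^-1.
Proof. by move=> a0; rewrite -powR_inv1 // powRAC powR_inv1 ?powR_ge0. Qed.

Lemma powRX (R : realType) (a p : R) (n : nat) : 0 <= a ->
  (a ^+ n) `^ p = (a `^ p) ^+ n.
Proof.
by move=> a0; rewrite -(powR_mulrn n a0) -(powR_mulrn n (powR_ge0 a p)) powRAC.
Qed.

(** [y] is the first term at which the running sum of the weights reaches [s]. For [s = 0] the mass
    condition alone would admit an empty list, hence the size condition. *)
Lemma seq_split_mass (R : realType) (T : Type) (w : T -> R) (s : R) (l : seq T) :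
  0 <= s -> (0 < size l)%N -> s <= \sum_(y <- l) w y ->
  exists l1 y l2, [/\ l = l1 ++ y :: l2, \sum_(z <- l1) w z <= s
    & s <= \sum_(z <- l1) w z + w y].
Proof.
elim: l s => // y l IH s s0 _; rewrite big_cons => sl.
have [sy|ys] := leP s (w y).
  by exists [::], y, l; rewrite big_nil add0r.
have l0 : (0 < size l)%N.
  by move: sl; case: l {IH} => //; rewrite big_nil addr0 leNgt ys.
have [||l1 [z [l2 [-> h1 h2]]]] := IH (s - w y) _ l0.
- by rewrite subr_ge0 ltW.
- by rewrite lerBlDl.
- exists (y :: l1), z, l2; split=> //; rewrite big_cons; first by rewrite -lerBrDl.
  by rewrite -addrA -lerBlDl.
Qed.

Section QuasiNorm.
Context {R : realType} {k : scalar_kind} {X : lmodType (scalars R k)}.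
Variable qn : X -> R.
Hypothesis hq : is_quasi_norm qn.

Lemma qn_ge0 f : 0 <= qn f.
Proof. by case: hq. Qed.

Lemma qnZ (a : scalars R k) f : qn (a *: f) = modulus a * qn f.
Proof. by case: hq. Qed.

Lemma qnZ_real (r : R) f : 0 <= r -> qn (of_real k r *: f) = r * qn f.
Proof. by move=> r0; rewrite qnZ modulus_of_real. Qed.

Lemma qn0 : qn 0 = 0.
Proof. by rewrite -(scale0r (0 : X)) qnZ modulus0 mul0r. Qed.

Lemma qnN f : qn (- f) = qn f.
Proof. by rewrite -scaleN1r qnZ modulusN modulus1 mul1r. Qed.

Lemma qnB f g : qn (f - g) = qn (g - f).
Proof. by rewrite -opprB qnN. Qed.

(* Subadditivity of [qn `^ p] up to a constant that does not depend on the
   number of terms; it holds for every quasi-norm when [p] is small enough. *)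
Definition power_subadditive (p K : R) : Prop := forall l : seq X,
  qn (\sum_(f <- l) f) `^ p <= K * \sum_(f <- l) qn f `^ p.

Lemma power_subadditive1 (p : R) : 0 < p ->
  (forall f g, qn (f + g) `^ p <= qn f `^ p + qn g `^ p) ->
  power_subadditive p 1.
Proof.
move=> p0 hp l; rewrite mul1r; elim: l => [|f l IH].
  by rewrite !big_nil qn0 powR0 ?gt_eqF.
rewrite !big_cons; apply: (le_trans (hp _ _)).
by rewrite lerD2l.
Qed.

(* The family is cut at a term [g] where half of the total mass is reached, so
   that the two remaining parts have at most half of the mass; [2 `^ p^-1] is
   chosen large enough to absorb the constants of the triangle inequality. *)
Lemma quasi_norm_power_subadditive :
  exists p K : R, [/\ 0 < p, 1 <= K & power_subadditive p K].
Proof.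
have [_ _ _ [kap kap1 tri]] := hq.
have kap0 : 0 < kap by apply: lt_le_trans kap1.
have ln20 : 0 < ln 2 :> R by rewrite ln_gt0 // ltr1n.
have k4 : 1 < 4 * kap ^+ 2 by rewrite expr2; nra.
have ln40 : 0 < ln (4 * kap ^+ 2) by rewrite ln_gt0.
(* With this [p], halving the mass divides its root of exponent [p^-1] by exactly [4 * kap ^+ 2]. *)
pose p := ln 2 / ln (4 * kap ^+ 2); have p0 : 0 < p by rewrite divr_gt0.
have half_p : 2^-1 `^ p^-1 = (4 * kap ^+ 2)^-1 :> R.
  rewrite /powR invr_eq0 pnatr_eq0 /= lnV ?posrE // /p invf_div.
  by rewrite mulrN divfK ?gt_eqF // expRN lnK // posrE; lra.
(* Each outer part then costs at most half of the root [s] of the mass, and two triangle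
   inequalities give [kap / 2 + 3 * kap ^+ 2 / 2 <= c]. *)
pose c := 2 * kap ^+ 2.
have c1 : 1 <= c by rewrite /c expr2; nra.
have key l : qn (\sum_(f <- l) f) <= c * (\sum_(f <- l) qn f `^ p) `^ p^-1.
  have [n] := ubnP (size l); elim: n l => // n IH l; rewrite ltnS => ln.
  have [/size0nil->|l0] := posnP (size l).
    by rewrite !big_nil qn0 mulr_ge0 ?powR_ge0 // (le_trans _ c1).
  set S := \sum_(f <- l) qn f `^ p.
  have S0 : 0 <= S by apply: sumr_ge0 => f _; exact: powR_ge0.
  have [| |l1 [g [l2 [El h1 h2]]]] :=
      @seq_split_mass R _ (fun f => qn f `^ p) (2^-1 * S) l _ l0.
  - by rewrite mulr_ge0.
  - by rewrite ler_piMl //; lra.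
  have ES : S = \sum_(f <- l1) qn f `^ p + (qn g `^ p + \sum_(f <- l2) qn f `^ p).
    by rewrite /S El big_cat big_cons.
  have sum0 l' : 0 <= \sum_(f <- l') qn f `^ p.
    by apply: sumr_ge0 => f _; exact: powR_ge0.
  have h3 : \sum_(f <- l2) qn f `^ p <= 2^-1 * S by lra.
  have sz : size l = (size l1 + (size l2).+1)%N by rewrite El size_cat.
  set s := S `^ p^-1; have s0 : 0 <= s := powR_ge0 _ _.
  have part l' : (size l' < n)%N -> \sum_(f <- l') qn f `^ p <= 2^-1 * S ->
      qn (\sum_(f <- l') f) <= c * ((4 * kap ^+ 2)^-1 * s).
    move=> ln' hl'; apply: le_trans (IH _ ln') _.
    rewrite ler_pM2l ?(lt_le_trans _ c1) // -half_p -powRM //.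
    by apply: powR_monotone; rewrite ?invr_gt0 ?sum0.
  have q1 : qn (\sum_(f <- l1) f) <= c * ((4 * kap ^+ 2)^-1 * s).
    by apply: part => //; apply: leq_trans ln; rewrite sz addnS ltnS leq_addr.
  have q2 : qn (\sum_(f <- l2) f) <= c * ((4 * kap ^+ 2)^-1 * s).
    by apply: part => //; apply: leq_trans ln; rewrite sz leq_addl.
  have qg : qn g <= s.
    rewrite -[qn g](@powRK _ p) ?qn_ge0 ?gt_eqF //.
    apply: powR_monotone; rewrite ?invr_gt0 ?powR_ge0 //.
    by have := sum0 l1; have := sum0 l2; lra.
  rewrite El big_cat big_cons /=.
  apply: le_trans (tri _ _) _.
  have := tri g (\sum_(f <- l2) f).
  have E : c * ((4 * kap ^+ 2)^-1 * s) = 2^-1 * s.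
    by rewrite /c; field; rewrite gt_eqF.
  rewrite E in q1 q2; rewrite /c expr2 => h4.
  apply: (@le_trans _ _ (kap * (2^-1 * s + kap * (s + 2^-1 * s)))).
    rewrite ler_pM2l //; apply: lerD => //; apply: le_trans h4 _.
    by rewrite ler_pM2l // lerD.
  have : kap * s <= kap * kap * s by rewrite ler_wpM2r // ler_peMl // ltW.
  lra.
exists p, (c `^ p); split => //.
  by have := powR_monotone p0 ler01 c1; rewrite powR1.
move=> l; set S := \sum_(f <- l) qn f `^ p; have S0 : 0 <= S.
  by apply: sumr_ge0 => f _; exact: powR_ge0.
rewrite -[X in _ * X](@powRVK _ p) ?gt_eqF // -powRM ?powR_ge0 //; last by lra.
by apply: powR_monotone; rewrite ?qn_ge0.
Qed.

End QuasiNorm.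

(** * Geometric series and multiplier estimates *)

Lemma sum_expr_le (R : realFieldType) (s : R) (n : nat) : 0 <= s -> s < 1 ->
  \sum_(i < n) s ^+ i <= (1 - s)^-1.
Proof.
move=> s0 s1; have s10 : 0 < 1 - s by rewrite subr_gt0.
rewrite -[leRHS]mul1r ler_pdivlMr // -opprB mulrN mulrC -subrX1 opprB.
by rewrite gerBl exprn_ge0.
Qed.

(** Serves every limiting argument below: remainders of binary expansions, perturbations,
    approximation by finite sums and normalization. *)
Lemma le_expr_lim (R : realType) (s a b y : R) : 0 <= s -> s < 1 ->
  (forall n, y <= a + s ^+ n * b) -> y <= a.
Proof.
move=> s0 s1 h.
have : (fun n => a + s ^+ n * b) @ \oo --> a + 0 * b.
  by apply: cvgD; [exact: cvg_cst|apply: cvgMl; apply: cvg_expr; rewrite ger0_norm].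
rewrite mul0r addr0 => c; rewrite -(cvg_lim _ c) //.
by apply: limr_ge; [apply/cvg_ex; exists a|exact: nearW].
Qed.

Section PowerSubadditive.
Context {R : realType} {k : scalar_kind} {X : lmodType (scalars R k)}.
Variables (qn : X -> R) (p K : R).
Hypotheses (hq : is_quasi_norm qn) (p0 : 0 < p) (K1 : 1 <= K).
Hypothesis sub : power_subadditive qn p K.

Lemma qn_sum_le (I : Type) (r : seq I) (P : pred I) (F : I -> X) :
  qn (\sum_(i <- r | P i) F i) `^ p <= K * \sum_(i <- r | P i) qn (F i) `^ p.
Proof. by have := sub [seq F i | i <- r & P i]; rewrite !big_map !big_filter. Qed.

Lemma qn_sumD_le (I : Type) (r : seq I) (F : I -> X) (g : X) :
  qn (\sum_(i <- r) F i + g) `^ p <=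
    K * (\sum_(i <- r) qn (F i) `^ p + qn g `^ p).
Proof.
by have := sub (g :: [seq F i | i <- r]); rewrite !big_cons !big_map !(addrC _ (\sum_(_ <- _) _)).
Qed.

Lemma qnD_le f g : qn (f + g) `^ p <= K * (qn f `^ p + qn g `^ p).
Proof. by have := sub [:: f; g]; rewrite !big_cons !big_nil !addr0. Qed.

(* Binary digits: the multipliers [a i] are replaced by the 0/1 multipliers of
   their binary expansions, whose weights [2^-k] are summable to the power [p]. *)
Lemma qn_multiplier_le (I : Type) (r : seq I) (v : I -> X) (M : R)
    (a : I -> R) :
  (forall P : pred I, qn (\sum_(i <- r | P i) v i) <= M) ->
  (forall i, 0 <= a i <= 1) ->
  qn (\sum_(i <- r) of_real k (a i) *: v i) `^ p <= K * (M `^ p / (2 `^ p - 1)).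
Proof.
move=> hM a01.
pose s : R := 2^-1 `^ p.
have s0 : 0 < s by rewrite powR_gt0.
have s1 : s < 1 by apply: powR_lt1 => //; lra.
have two_p : 2 `^ p = s^-1 by rewrite /s powRV // invrK.
(* [dig b] is the leading binary digit and [rest b] the shifted remainder; the value 1 has all
   digits 1, so [rest] stays in [[0, 1]]. *)
pose dig (b : I -> R) i := 1 <= 2 * b i.
pose rest (b : I -> R) i := 2 * b i - (dig b i)%:R.
have rest01 (b : I -> R) : (forall i, 0 <= b i <= 1) -> forall i, 0 <= rest b i <= 1.
  move=> b01 i; have /andP[b0 b1] := b01 i.
  by rewrite /rest /dig; case: (leP 1 (2 * b i)) => h /=; rewrite ?subr0; apply/andP; split; lra.
pose an n := iter n rest a.
have an01 n : forall i, 0 <= an n i <= 1 by elim: n => //= n IH; exact: rest01.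
pose S b := \sum_(i <- r) of_real k (b i) *: v i.
have step b : S b = of_real k 2^-1 *: (\sum_(i <- r | dig b i) v i + S (rest b)).
  rewrite [in RHS]big_mkcond /S -big_split scaler_sumr; apply: eq_bigr => i _.
  rewrite /rest; case: ifP => _ /=; rewrite ?subr0 ?add0r ?scalerA -?of_realM.
    rewrite -[X in X + _]scale1r -of_real1 -scalerDl -of_realD scalerA -of_realM.
    by congr (of_real _ _ *: _); lra.
  by congr (of_real _ _ *: _); lra.
have expand n : S a = \sum_(j < n) of_real k (2^-1 ^+ j.+1) *:
    (\sum_(i <- r | dig (an j) i) v i) + of_real k (2^-1 ^+ n) *: S (an n).
  elim: n => [|n ->]; first by rewrite big_ord0 add0r expr0 of_real1 scale1r.
  rewrite big_ord_recr /= -addrA; congr (_ + _).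
  by rewrite step -/(an _.+1) scalerA -of_realM -exprSr scalerDr.
(* [D] depends on [r] and [v], but it enters only through the remainder, with a factor [s ^+ n], and
   disappears in the limit. *)
pose D := K * \sum_(i <- r) qn (v i) `^ p.
have hD n : qn (S (an n)) `^ p <= D.
  apply: (le_trans (qn_sum_le _ _ _)); rewrite ler_pM2l ?(lt_le_trans _ K1) //.
  apply: ler_sum => i _; have /andP[b0 b1] := an01 n i.
  by apply: powR_monotone; rewrite ?(qn_ge0 hq) // qnZ_real // ler_piMl ?(qn_ge0 hq).
have M0 : 0 <= M by have := hM pred0; rewrite big_pred0_eq (qn0 hq).
apply: (@le_expr_lim _ s _ (K * D)) => [||n]; rewrite ?(ltW s0) //.
rewrite -/(S a) (expand n).
apply: (le_trans (qn_sumD_le _ _ _)).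
rewrite [X in _ <= _ + X]mulrCA -mulrDr ler_pM2l ?(lt_le_trans _ K1) //; apply: lerD; last first.
  rewrite qnZ_real ?exprn_ge0 ?invr_ge0 // powRM ?exprn_ge0 ?(qn_ge0 hq) ?invr_ge0 //.
  by rewrite powRX ?invr_ge0 // -/s ler_pM2l ?exprn_gt0.
apply: (@le_trans _ _ (\sum_(j < n) s ^+ j * (s * M `^ p))).
  apply: ler_sum => j _.
  rewrite qnZ_real ?exprn_ge0 ?invr_ge0 // powRM ?exprn_ge0 ?(qn_ge0 hq) ?invr_ge0 //.
  rewrite powRX ?invr_ge0 // -/s exprSr -mulrA ler_pM2l ?exprn_gt0 // ler_pM2l //.
  by apply: powR_monotone; rewrite ?(qn_ge0 hq).
rewrite -mulr_suml.
apply: (@le_trans _ _ ((1 - s)^-1 * (s * M `^ p))).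
  by rewrite ler_wpM2r ?sum_expr_le ?mulr_ge0 ?powR_ge0 ?ltW.
rewrite two_p le_eqVlt; apply/orP; left; apply/eqP; field.
by rewrite gt_eqF //= mulN1r subr_eq0 gt_eqF.
Qed.

End PowerSubadditive.

(** * Finite sums over a basis *)

Section FiniteSums.
Context {R : realType} {k : scalar_kind} {X : lmodType (scalars R k)}.
Variables (x : nat -> X) (xs : nat -> {scalar X}).
Hypothesis biorth : forall n j, xs n (x j) = (n == j)%:R.
Implicit Types (A B E : set nat) (c d : nat -> scalars R k).

(** One enumeration of a larger set [E], filtered by membership in [A], lets sums over different
    subsets be combined term by term. *)
Lemma indE E A c : finite_set E -> A `<=` E ->
  ind x c A = \sum_(i <- enum_fset (fset_set E) | i \in A) c i *: x i.
Proof.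
move=> fE AE; have fA := sub_finite_set AE fE.
rewrite /ind fsbig_finite // -[RHS]big_filter; apply: perm_big.
apply: uniq_perm => [| |i]; rewrite ?filter_uniq ?fset_uniq //.
rewrite mem_filter !in_fset_set //.
by apply/idP/andP => [/set_mem Ai|[/set_mem Ai _]]; [split|]; apply/mem_set => //; exact: AE.
Qed.

Lemma ind_eq A c d : {in A, c =1 d} -> ind x c A = ind x d A.
Proof. by move=> cd; apply: eq_fsbigr => i /cd ->. Qed.

Lemma ind0 c : ind x c set0 = 0.
Proof. exact: fsbig_set0. Qed.

Lemma indD A c d : finite_set A ->
  ind x (fun n => c n + d n) A = ind x c A + ind x d A.
Proof.
move=> fA; rewrite !(indE _ fA) // -big_split.
by apply: eq_bigr => i _; rewrite scalerDl.
Qed.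

Lemma indZ A a c : finite_set A -> a *: ind x c A = ind x (fun n => a * c n) A.
Proof.
move=> fA; rewrite !(indE _ fA) // scaler_sumr.
by apply: eq_bigr => i _; rewrite scalerA.
Qed.

Lemma ind_setD A B c : finite_set A -> B `<=` A ->
  ind x c (A `\` B) = ind x c A - ind x c B.
Proof.
move=> fA BA; apply/eqP; rewrite eq_sym subr_eq; apply/eqP.
by rewrite /ind -fsbigU0 ?setDKU //; [exact: finite_setD|exact: sub_finite_set fA|move=> n [[]]].
Qed.

Lemma coord_ind A c j : finite_set A ->
  xs j (ind x c A) = if j \in A then c j else 0.
Proof.
move=> fA; rewrite (indE _ fA) // linear_sum.
under eq_bigr => i _ do rewrite linearZ /= biorth.
have [jA|jA] := boolP (j \in A).
  rewrite -big_filter (bigD1_seq j) ?filter_uniq ?fset_uniq //=; last first.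
    by rewrite mem_filter jA in_fset_set.
  rewrite eqxx mulr1 big1 ?addr0 // => i ij.
  by rewrite eq_sym (negbTE ij) mulr0.
rewrite big1 // => i iA; case: eqVneq => [ji|]; last by rewrite mulr0.
by rewrite ji iA in jA.
Qed.

Lemma proj_ind A E c : finite_set E -> A `<=` E ->
  Defs.proj x xs A (ind x c E) = ind x c A.
Proof.
move=> fE AE; apply: ind_eq => i /set_mem Ai /=.
by rewrite coord_ind // mem_set //; exact: AE.
Qed.

Lemma projD A f g : finite_set A ->
  Defs.proj x xs A (f + g) = Defs.proj x xs A f + Defs.proj x xs A g.
Proof.
by move=> fA; rewrite -indD //; apply: ind_eq => i _; rewrite linearD.
Qed.

Lemma projZ A a f : finite_set A ->
  Defs.proj x xs A (a *: f) = a *: Defs.proj x xs A f.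
Proof.
by move=> fA; rewrite [RHS]indZ //; apply: ind_eq => i _; rewrite linearZ.
Qed.

Lemma projB A f g : finite_set A ->
  Defs.proj x xs A (f - g) = Defs.proj x xs A f - Defs.proj x xs A g.
Proof. by move=> fA; rewrite projD // -scaleN1r projZ // scaleN1r. Qed.

Lemma coord_proj A f j : finite_set A ->
  xs j (Defs.proj x xs A f) = if j \in A then xs j f else 0.
Proof. exact: coord_ind. Qed.

Lemma linear_spanP g : linear_span x g ->
  exists E c, finite_set E /\ g = ind x c E.
Proof.
move=> [n [c ->]]; exists `I_n, c; split; first exact: finite_II.
by rewrite /ind -(fsbig_ord _ _ (fun i => c i *: x i)).
Qed.

Definition sgn_sum (f : X) (A : set nat) : X :=
  ind x (fun n => sign (xs n f)) A.

Lemma restricted_truncE f A n0 : A n0 ->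
  (forall n, A n -> modulus (xs n0 f) <= modulus (xs n f)) ->
  restricted_trunc x xs f A = of_real k (modulus (xs n0 f)) *: sgn_sum f A.
Proof.
move=> An0 hmin; rewrite /restricted_trunc; congr (of_real _ _ *: _).
apply/eqP; rewrite eq_le; apply/andP; split.
  apply: ge_inf; last by exists n0.
  by exists 0 => _ [n _ <-]; exact: modulus_ge0.
by apply: lb_le_inf; [exists (modulus (xs n0 f)), n0|move=> _ [n An <-]; exact: hmin].
Qed.

Lemma exists_argmin f A : finite_set A -> A !=set0 ->
  exists2 n0, A n0 & forall n, A n -> modulus (xs n0 f) <= modulus (xs n f).
Proof.
move=> fA [a Aa].
pose r := enum_fset (fset_set A).
have inr n : (n \in r) = (n \in A) by rewrite in_fset_set.
suff [n0 rn0 h] : exists2 n0, n0 \in r &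
    forall n, n \in r -> modulus (xs n0 f) <= modulus (xs n f).
  by exists n0 => [|n An]; [apply/set_mem; rewrite -inr|apply: h; rewrite inr mem_set].
have : a \in r by rewrite inr mem_set.
elim: r {inr Aa} a => // b l IH a _.
case: l IH => [_|a' l /(_ a' (mem_head _ _))[n0 ln0 h]].
  by exists b => [|n] /=; rewrite ?mem_head // inE => /eqP->.
have [le|/ltW le] := leP (modulus (xs b f)) (modulus (xs n0 f)).
  exists b => [|n] /=; rewrite ?mem_head // inE => /predU1P[->//|/h].
  exact: le_trans.
by exists n0 => [|n] /=; rewrite inE ?ln0 ?orbT // => /predU1P[->//|/h].
Qed.

Lemma greedy_ind E c : finite_set E -> greedy_set xs (ind x c E) E.
Proof.
move=> fE n j _ Ej; rewrite (coord_ind _ j) // memNset // modulus0.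
exact: modulus_ge0.
Qed.

End FiniteSums.

(** * Restricted truncations *)

Lemma expr_unbounded (R : realType) (a y : R) : 1 < a -> exists n, y < a ^+ n.
Proof.
move=> a1.
have : (fun n => a^-1 ^+ n) @ \oo --> (0 : R).
  by apply: cvg_expr; rewrite ger0_norm ?invf_lt1 ?invr_ge0 //; lra.
move=> /cvgrPdist_lt /(_ (`|y| + 1)^-1) [|n _ /(_ n (leqnn n))].
  by rewrite invr_gt0 ltr_wpDl.
have a0 : 0 < a ^+ n by apply: exprn_gt0; lra.
rewrite /= sub0r normrN exprVn ger0_norm; last by rewrite invr_ge0 ltW.
rewrite ltf_pV2 ?posrE ?ltr_wpDl // => h.
exists n; apply: le_lt_trans (ler_norm y) _; lra.
Qed.

Lemma expr_bracket (R : realType) (a y : R) : 1 < a -> 1 <= y ->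
  exists n, a ^+ n <= y < a ^+ n.+1.
Proof.
move=> a1 y1; have ex : exists n, y < a ^+ n by exact: expr_unbounded.
(* The least exponent with [y < a ^+ n] is positive because [1 <= y]; its predecessor gives the
   lower bound. *)
case: (ex_minnP ex) => -[|n] yn hmin; first by move: yn; rewrite expr0; lra.
exists n; rewrite yn andbT leNgt; apply/negP => /hmin.
by rewrite ltnn.
Qed.

(** Explains [A_const] in [eta]: it cancels the denominator left by the geometric series of binary
    weights. *)
Lemma A_const_invX (R : realType) (p : R) : 0 < p ->
  ((A_const p)^-1) `^ p = 2 `^ p - 1.
Proof.
move=> p0; have p2 : 0 < 2 `^ p - 1 by rewrite subr_gt0 powR_gt1 // ltr1n.
by rewrite /A_const powRN invrK powRVK ?gt_eqF // ltW.
Qed.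

Lemma A_const_gt0 (R : realType) (p : R) : 0 < p -> 0 < A_const p.
Proof.
by move=> p0; rewrite powR_gt0 // subr_gt0 powR_gt1 // ltr1n.
Qed.

(** Extracts [p]-th roots so that [a] and [b] become the two factors of the expression minimized in
    [eta]. *)
Lemma le_mul_roots (R : realType) (p u a b c : R) : 0 < p ->
  0 < a -> 0 < b -> 0 <= u -> 0 <= c -> u `^ p * a * b <= c `^ p ->
  u <= a `^ (- p^-1) * b `^ (- p^-1) * c.
Proof.
move=> p0 a0 b0 u0 c0 h.
have root y : 0 < y -> (y `^ - p^-1) `^ p = y^-1.
  by move=> y0; rewrite powRN powRV ?powR_ge0 // powRVK ?gt_eqF // ltW.
apply: (powR_le_inj p0); rewrite ?mulr_ge0 ?powR_ge0 //.
rewrite !powRM ?mulr_ge0 ?powR_ge0 // !root //.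
by rewrite [leRHS]mulrC mulrA !ler_pdivlMr // mulrAC.
Qed.

Lemma eta_term_gt0 (R : realType) (p C t : R) : 0 < p -> 0 < C -> 0 < t ->
  0 < 1 - (1 + (A_const p)^-1 * C^-1 * t) `^ (- p).
Proof.
move=> p0 C0 t0; rewrite subr_gt0 powRN invf_lt1; last first.
  by rewrite powR_gt0 // addr_gt0 // !mulr_gt0 ?invr_gt0 ?A_const_gt0.
by rewrite powR_gt1 // ltrDl !mulr_gt0 ?invr_gt0 ?A_const_gt0.
Qed.

Section RestrictedTruncation.
Context {R : realType} {k : scalar_kind} {X : lmodType (scalars R k)}.
Variables (qn : X -> R) (x : nat -> X) (xs : nat -> {scalar X}).
Hypothesis hq : is_quasi_norm qn.
Hypothesis biorth : forall n j, xs n (x j) = (n == j)%:R.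

(** The admissible constants in the infimum [C_qg]; a difference of greedy sets cuts out a band of
    coefficients at once. *)
Definition qg_bound (C : R) : Prop := forall f A B, finite_set A ->
  greedy_set xs f A -> greedy_set xs f B -> B `<=` A ->
  qn (Defs.proj x xs (A `\` B) f) <= C * qn f.

Lemma greedy0 f : greedy_set xs f set0.
Proof. by []. Qed.

Lemma qg_bound0 C f A : qg_bound C -> finite_set A -> greedy_set xs f A ->
  qn (Defs.proj x xs A f) <= C * qn f.
Proof.
by move=> hC fA gA; rewrite -(setD0 A); apply: hC => //; exact: greedy0.
Qed.

(** The coordinates of a sign sum have modulus one on [A] and vanish elsewhere, so every subset of
    [A] is one of its greedy sets. *)
Lemma qg_bound_sgn_sum C f A B : qg_bound C -> finite_set A -> B `<=` A ->
  qn (sgn_sum x xs f B) <= C * qn (sgn_sum x xs f A).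
Proof.
move=> hC fA BA; rewrite {1}/sgn_sum -(proj_ind biorth _ fA BA).
apply: qg_bound0 => //; first exact: sub_finite_set fA.
move=> n j Bn _; have An : n \in A by apply/mem_set; exact: BA.
rewrite !(coord_ind biorth) // An modulus_sign.
by case: ifP => _; rewrite ?modulus_sign ?modulus0 ?ler01.
Qed.

Lemma sgn_sum0 f : sgn_sum x xs f set0 = 0.
Proof. exact: ind0. Qed.

Lemma restricted_trunc0 f : restricted_trunc x xs f set0 = 0.
Proof. by rewrite /restricted_trunc fsbig_set0 scaler0. Qed.

(* The denominator [C] in [lam = 1 + t / (A_const p * C)] makes the error
   [h / alpha - sgn_sum f A] of size at most [t * qn (sgn_sum f A)] (up to [K]),
   so that it is absorbed by the left-hand side. *)
Lemma restricted_trunc_le (p K C t : R) f A :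
  0 < p -> 1 <= K -> power_subadditive qn p K -> 0 < C -> qg_bound C -> 0 < t ->
  finite_set A -> greedy_set xs f A ->
  qn (restricted_trunc x xs f A) `^ p * (1 - K ^+ 2 * t `^ p) *
    (1 - (1 + (A_const p)^-1 * C^-1 * t) `^ (- p)) <= K ^+ 2 * (C * qn f) `^ p.
Proof.
move=> p0 K1 sub C0 hC t0 fA gA.
have K0 : 0 < K by apply: lt_le_trans K1.
have rhs0 : 0 <= K ^+ 2 * (C * qn f) `^ p by rewrite mulr_ge0 ?powR_ge0 // exprn_ge0 // ltW.
have [->|/set0P A0] := eqVneq A set0.
  by rewrite restricted_trunc0 (qn0 hq) powR0 ?gt_eqF // !mul0r.
have [n0 An0 hmin] := exists_argmin xs f fA A0.
rewrite (restricted_truncE _ An0 hmin).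
set al := modulus (xs n0 f); have al0 : 0 <= al := modulus_ge0 _.
rewrite qnZ_real //.
move: al0; rewrite le_eqVlt => /predU1P[<-|al0].
  by rewrite mul0r powR0 ?gt_eqF // !mul0r.
set lam := 1 + _ * t; set u := sgn_sum _ _ _ _.
have lam1 : 1 < lam by rewrite ltrDl !mulr_gt0 ?invr_gt0 ?A_const_gt0.
have lam0 : 0 < lam by lra.
(* Outside [A] the exponent is a dummy 0, so that [choice] yields a total function [jj]. *)
have ex n : exists j, n \in A ->
    lam ^+ j <= modulus (xs n f) / al < lam ^+ j.+1.
  have [/set_mem An|_] := boolP (n \in A); last by exists 0%N.
  have [|j hj] := @expr_bracket _ lam (modulus (xs n f) / al) lam1; last by exists j.
  by rewrite ler_pdivlMr // mul1r hmin.
have [jj hjj] := choice ex.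
pose r := enum_fset (fset_set A).
have inr n : (n \in r) = (n \in A) by rewrite in_fset_set.
pose J := (\max_(n <- r) jj n).+1.
have jjJ n : n \in r -> (jj n < J)%N by move=> rn; rewrite ltnS; exact: leq_bigmax_seq.
(* The level sets [E j] decrease with [j]; each is greedy since an exponent below [j] forces a
   smaller modulus. *)
pose E j := [set n | A n /\ (j <= jj n)%N].
have fE j : finite_set (E j) by apply: sub_finite_set fA => n [].
have gE j : greedy_set xs f (E j).
  move=> n m [An jn] Em; have [Am|Am] := pselect (A m); last exact: gA.
  have mj : (jj m < j)%N by rewrite ltnNge; apply/negP => jm; exact: Em.
  have /andP[_ h1] := hjj m (mem_set Am); have /andP[h2 _] := hjj n (mem_set An).
  rewrite -(ler_pM2r (_ : 0 < al^-1)) ?invr_gt0 //.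
  apply: (le_trans (ltW h1)); apply: le_trans h2.
  by rewrite ler_eXn2l // (leq_trans mj).
pose F j := Defs.proj x xs (E j `\` E j.+1) f.
have hF j : qn (F j) <= C * qn f.
  by apply: hC => // n [An jn]; split=> //; exact: ltnW.
(* An index [n] of [A] lies in exactly one difference of consecutive level sets, at [j = jj n], so
   [h] divides its coefficient by [lam ^+ jj n]. *)
pose h := \sum_(j < J) of_real k (lam ^- j) *: F j.
have hE : h = ind x (fun n => of_real k (lam ^- jj n) * xs n f) A.
  rewrite (indE _ _ fA) // /h -/r.
  under eq_bigr => j _.
    rewrite /F /Defs.proj -/(ind x (xs^~ f) _) (indE _ _ fA); last by move=> n [[]].
    rewrite scaler_sumr big_mkcond -/r; over.
  rewrite exchange_big /= big_seq_cond [RHS]big_seq_cond.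
  apply: eq_big => [n|n /andP[rn _]]; first by case: (boolP (n \in r)) => //; rewrite inr => ->.
  have An : A n by apply/set_mem; rewrite -inr.
  rewrite (bigD1 (Ordinal (jjJ n rn))) //= ifT; last first.
    by apply: mem_set; split; [split|move=> -[_]; rewrite /= ltnn].
  rewrite big1 ?addr0 ?scalerA // => j jn; rewrite memNset // => -[[_ jn1] jn2].
  apply/negP: jn; apply/negPn/eqP/val_inj => /=; apply/eqP.
  rewrite eqn_leq jn1 /= leqNgt; apply/negP => jn; exact: jn2.
pose b n := modulus (xs n f) / al / lam ^+ jj n.
have b1 n : n \in A -> 1 <= b n < lam.
  move=> /hjj /andP[h1 h2]; rewrite /b ler_pdivlMr ?exprn_gt0 // mul1r h1 /=.
  by rewrite ltr_pdivrMr ?exprn_gt0 // -exprS.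
(* Dividing by [lam - 1] brings the multipliers of [h / al - u] into [[0, 1]], as binary expansion
   requires. *)
pose a n := if n \in A then (b n - 1) / (lam - 1) else 0.
have a01 n : 0 <= a n <= 1.
  rewrite /a; case: ifP => [/b1/andP[h1 h2]|_]; last by rewrite lexx ler01.
  rewrite divr_ge0 /=; [|lra|lra].
  by rewrite ler_pdivrMr; lra.
pose w := \sum_(n <- r) of_real k (a n) *: (sign (xs n f) *: x n).
have uE : u = of_real k al^-1 *: h + of_real k (lam - 1) *: (- w).
  rewrite hE indZ // /u /sgn_sum /w scalerN scaler_sumr.
  rewrite !(indE _ _ fA) // -/r ![in RHS]big_mkcond [LHS]big_mkcond /= -sumrB.
  rewrite big_seq [RHS]big_seq; apply: eq_bigr => n; rewrite inr => An.
  rewrite An !scalerA -scalerBl; congr (_ *: _).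
  rewrite -{2}(modulus_mul_sign (xs n f)) !mulrA -!of_realM -mulrBl -of_realN -of_realD.
  rewrite /a An -[LHS]mul1r -of_real1; congr (of_real _ _ * _).
  rewrite /b; field; rewrite !gt_eqF ?exprn_gt0 //; lra.
set U := qn u; have U0 : 0 <= U by exact: qn_ge0.
have p2 : 0 < 2 `^ p - 1 by rewrite -A_const_invX // powR_gt0 // invr_gt0 A_const_gt0.
have hw : qn w `^ p <= K * ((C * U) `^ p / (2 `^ p - 1)).
  apply: (qn_multiplier_le hq) => // P.
  have -> : \sum_(n <- r | P n) sign (xs n f) *: x n =
      sgn_sum x xs f [set n | A n /\ P n].
    rewrite /sgn_sum (indE _ _ fA); last by move=> n [].
    rewrite -/r big_seq_cond [RHS]big_seq_cond; apply: eq_bigl => n.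
    have [|//] := boolP (n \in r); rewrite inr => An /=.
    by apply/idP/idP => [Pn|/set_mem[]//]; apply/mem_set; split=> //; exact/set_mem.
  by apply: qg_bound_sgn_sum => // n [].
pose G := 1 - lam `^ (- p).
have lamV : lam `^ (- p) = lam^-1 `^ p by rewrite powRN powRV ?ltW.
have lam_p : lam^-1 `^ p < 1.
  by apply: powR_lt1; rewrite ?invr_ge0 ?(ltW lam0) ?invf_lt1.
have G0 : 0 < G by rewrite /G lamV subr_gt0.
have hh : qn h `^ p <= K * ((C * qn f) `^ p / G).
  apply: (le_trans (qn_sum_le sub _ _ _)); rewrite ler_pM2l //.
  apply: (@le_trans _ _ (\sum_(j < J) (lam^-1 `^ p) ^+ j * (C * qn f) `^ p)).
    apply: ler_sum => j _; rewrite qnZ_real ?invr_ge0 ?exprn_ge0 ?(ltW lam0) //.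
    rewrite -exprVn powRM ?exprn_ge0 ?invr_ge0 ?(ltW lam0) ?(qn_ge0 hq) //.
    rewrite powRX ?invr_ge0 ?(ltW lam0) // ler_wpM2l ?exprn_ge0 ?powR_ge0 //.
    by apply: powR_monotone; rewrite ?(qn_ge0 hq).
  rewrite -mulr_suml mulrC ler_wpM2l ?powR_ge0 //.
  by rewrite /G lamV sum_expr_le ?powR_ge0.
have hU : U `^ p <= K * (al^-1 `^ p * (K * ((C * qn f) `^ p / G)) +
    (lam - 1) `^ p * (K * ((C * U) `^ p / (2 `^ p - 1)))).
  rewrite {1}/U uE; apply: (le_trans (qnD_le sub _ _)); rewrite ler_pM2l //.
  apply: lerD; rewrite qnZ_real ?invr_ge0 ?(ltW al0) ?subr_ge0 ?(ltW lam1) //.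
    by rewrite powRM ?invr_ge0 ?(ltW al0) ?(qn_ge0 hq) // ler_wpM2l ?powR_ge0.
  rewrite qnN // powRM ?(qn_ge0 hq) ?ler_wpM2l ?powR_ge0 //.
  by rewrite subr_ge0 ltW.
(* [lam] was chosen for this identity: [C] and the binary constant cancel, leaving only the factor
   [t] on [U]. *)
have lamB : (lam - 1) `^ p * ((C * U) `^ p / (2 `^ p - 1)) = t `^ p * U `^ p.
  have Ap0 : 0 <= A_const p by rewrite ltW ?A_const_gt0.
  rewrite /lam addrC addKr !powRM ?mulr_ge0 ?invr_ge0 ?(ltW C0) ?(ltW t0) //.
  rewrite A_const_invX //.
  rewrite powRV ?(ltW C0) //.
  by field; rewrite !gt_eqF ?powR_gt0.
rewrite [X in _ * (_ + X)]mulrCA lamB in hU.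
have -> : 1 - lam `^ (- p) = G by [].
rewrite powRM ?(ltW al0) //.
rewrite powRV ?(ltW al0) // in hU.
have alp : 0 < al `^ p by rewrite powR_gt0.
(* Multiplied by [G] and the [p]-th power of [al], the difference of the sides of [hU] is that of
   the goal. *)
have := hU; rewrite -subr_ge0 -(pmulr_rge0 _ (mulr_gt0 alp G0)) -[_ <= K ^+ 2 * _]subr_ge0.
congr (0 <= _); field; by rewrite !gt_eqF.
Qed.

End RestrictedTruncation.

(** * Truncations and tie breaking *)

Lemma card_eq_sub (A B : set nat) : finite_set A -> (A #= B)%card ->
  B `<=` A -> A = B.
Proof.
move=> fA AB BA; have fB := sub_finite_set BA fA.
apply/esym/(fset_set_inj fB fA)/eqP; rewrite eqEfcard.
apply/andP; split; first by rewrite -fset_set_sub.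
by move/(fcard_eq fA fB): AB => ->.
Qed.

Section Truncation.
Context {R : realType} {k : scalar_kind} {X : lmodType (scalars R k)}.
Variables (qn : X -> R) (x : nat -> X) (xs : nat -> {scalar X}).
Hypothesis hq : is_quasi_norm qn.
Hypothesis biorth : forall n j, xs n (x j) = (n == j)%:R.
Local Notation proj := (Defs.proj x xs).

(** Two sets of equal size, neither inside the other, yield [j] in [A] only and [n] in [B] only;
    each would strictly precede the other in the order by modulus, then index. *)
Lemma mth_greedy_set_inj f m A B : is_mth_greedy_set xs f m A ->
  is_mth_greedy_set xs f m B -> A = B.
Proof.
move=> [cA hA] [cB hB].
have AB : (A #= B)%card by rewrite (card_eq_trans cA) // card_eq_sym.
have fA : finite_set A by rewrite (eq_finite_set cA); exact: finite_II.
have [BA|/existsNP[n /not_implyP[Bn An]]] := pselect (B `<=` A).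
  exact: card_eq_sub.
have fB : finite_set B by rewrite (eq_finite_set cB); exact: finite_II.
have [AB'|/existsNP[j /not_implyP[Aj Bj]]] := pselect (A `<=` B).
  by apply/esym/card_eq_sub => //; rewrite card_eq_sym.
have := hA j n Aj An; have := hB n j Bn Bj.
case=> [h1|[h1 h2]] [h3|[h3 h4]].
- by have := lt_trans h1 h3; rewrite ltxx.
- by rewrite h3 ltxx in h1.
- by rewrite h1 ltxx in h3.
- by have := ltn_trans h2 h4; rewrite ltnn.
Qed.

Lemma mth_greedy_setE f m A : is_mth_greedy_set xs f m A ->
  mth_greedy_set xs f m = A.
Proof.
move=> hA; apply: xget_unique => // B hB.
exact: mth_greedy_set_inj hB hA.
Qed.

(** Should no [m]-th greedy set exist, the default [set0] of [xget] is still finite and greedy. *)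
Lemma mth_greedy_set_greedy f m :
  finite_set (mth_greedy_set xs f m) /\ greedy_set xs f (mth_greedy_set xs f m).
Proof.
rewrite /mth_greedy_set; case: xgetP => [A _ [cA hA]|_]; last first.
  by split; [exact: finite_set0|].
split; first by rewrite (eq_finite_set cA); exact: finite_II.
by move=> n j An Aj; case: (hA n j An Aj) => [/ltW|[->]].
Qed.

Lemma truncE f A : finite_set A ->
  trunc x xs f A = restricted_trunc x xs f A + (f - proj A f).
Proof. by move=> fA; rewrite /trunc asboolT. Qed.

Lemma coordZ (a : scalars R k) f n :
  modulus (xs n (a *: f)) = modulus a * modulus (xs n f).
Proof. by rewrite linearZ modulusM. Qed.

Lemma truncZ r f A : 0 < r -> finite_set A ->
  trunc x xs (of_real k r *: f) A = of_real k r *: trunc x xs f A.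
Proof.
move=> r0 fA; rewrite !truncE // (projZ _ _ _ _) // scalerDr scalerBr.
congr (_ + _); have [->|/set0P A0] := eqVneq A set0.
  by rewrite !restricted_trunc0 scaler0.
have [n0 An0 hmin] := exists_argmin xs f fA A0.
rewrite (restricted_truncE _ An0 hmin) (@restricted_truncE _ _ _ _ _ _ _ n0) //.
  rewrite coordZ modulus_of_real ?(ltW r0) // of_realM -scalerA; congr (_ *: (_ *: _)).
  by apply: ind_eq => n _; rewrite linearZ sign_real_mul.
by move=> n An; rewrite !coordZ modulus_of_real ?(ltW r0) // ler_pM2l // hmin.
Qed.

Lemma greedy_setZ r f A : 0 < r -> greedy_set xs f A ->
  greedy_set xs (of_real k r *: f) A.
Proof.
move=> r0 gA n j An Aj; rewrite !coordZ modulus_of_real ?(ltW r0) //.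
by rewrite ler_pM2l // gA.
Qed.

Lemma mth_greedy_setZ r f m A : 0 < r -> is_mth_greedy_set xs f m A ->
  is_mth_greedy_set xs (of_real k r *: f) m A.
Proof.
move=> r0 [cA hA]; split=> // n j An Aj.
rewrite !coordZ modulus_of_real ?(ltW r0) // ltr_pM2l //.
by case: (hA n j An Aj) => [|[-> ?]]; [left|right].
Qed.

Section Perturbation.
Variables (f : X) (A : set nat) (e : R).
Hypotheses (fA : finite_set A) (e0 : 0 < e).
Let s := sgn_sum x xs f A.
(* Raising the coefficients on a greedy set [A] by [e] makes [A] strictly
   greedy, hence independent of the rule that breaks ties. *)
Definition raise : X := f + of_real k e *: s.

Lemma coord_raise n :
  xs n raise = if n \in A then of_real k (modulus (xs n f) + e) * sign (xs n f)
               else xs n f.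
Proof.
rewrite linearD linearZ /= (coord_ind biorth) //; case: ifP => _; last first.
  by rewrite mulr0 addr0.
by rewrite of_realD mulrDl modulus_mul_sign.
Qed.

Lemma modulus_coord_raise n : modulus (xs n raise) =
  modulus (xs n f) + (if n \in A then e else 0).
Proof.
rewrite coord_raise; case: ifP => _; last by rewrite addr0.
by rewrite modulusM modulus_sign mulr1 modulus_of_real // addr_ge0 ?modulus_ge0 ?ltW.
Qed.

(** The gap [e] excludes ties and tolerates an error of [e / 2] in every coefficient, which keeps
    [A] greedy for nearby vectors. *)
Lemma raise_gap n j : greedy_set xs f A -> A n -> ~ A j ->
  modulus (xs j raise) + e <= modulus (xs n raise).
Proof.
move=> gA An Aj; rewrite !modulus_coord_raise (mem_set An) memNset // addr0.
by rewrite lerD2r gA.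
Qed.

Lemma sgn_sum_raise : sgn_sum x xs raise A = s.
Proof.
apply: ind_eq => n nA; rewrite coord_raise nA.
by rewrite sign_real_mul ?ltr_wpDl ?modulus_ge0 // sign_id.
Qed.

Lemma trunc_raise : trunc x xs raise A = trunc x xs f A + of_real k e *: s.
Proof.
rewrite !truncE // /raise projD // projZ //.
rewrite [proj A s](proj_ind biorth) // -/s -/raise.
rewrite opprD addrACA subrr addr0 addrAC; congr (_ + _).
have [EA|/set0P A0] := eqVneq A set0.
  by rewrite /s EA !restricted_trunc0 sgn_sum0 scaler0 addr0.
have [n0 An0 hmin] := exists_argmin xs f fA A0.
rewrite (restricted_truncE _ An0 hmin) (@restricted_truncE _ _ _ _ _ _ _ n0) //.
  rewrite sgn_sum_raise modulus_coord_raise (mem_set An0).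
  by rewrite of_realD scalerDl.
by move=> n An; rewrite !modulus_coord_raise (mem_set An0) (mem_set An) lerD2r hmin.
Qed.

Lemma mth_greedy_set_raise : greedy_set xs f A ->
  exists m, is_mth_greedy_set xs raise m A.
Proof.
move=> gA; have [m cA] := (finite_setP A).1 fA.
exists m; split=> // n j An Aj; left.
by apply: lt_le_trans (raise_gap gA An Aj); rewrite ltrDl.
Qed.

End Perturbation.

(** Divided by the least modulus [al] on [A], the truncation is a sign sum plus a vector vanishing
    on [A] with coefficients of modulus at most one: a [QGLC_pair]. *)
Lemma proj_compl_le_trunc Q f A :
  (forall eps B g, QGLC_pair xs eps B g -> qn g <= Q * qn (g + ind x eps B)) ->
  1 <= Q -> finite_set A -> greedy_set xs f A ->
  qn (f - proj A f) <= Q * qn (trunc x xs f A).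
Proof.
move=> hQ Q1 fA gA; rewrite truncE //.
(* Covers [A] empty and [al = 0]: the truncation is then [f - proj A f] itself, and [1 <= Q]
   suffices. *)
have easy h : h = 0 -> qn (f - proj A f) <= Q * qn (h + (f - proj A f)).
  by move=> ->; rewrite add0r ler_peMl // qn_ge0.
have [A0|/set0P A0] := eqVneq A set0.
  by apply: easy; rewrite A0 restricted_trunc0.
have [n0 An0 hmin] := exists_argmin xs f fA A0.
rewrite (restricted_truncE _ An0 hmin).
set al := modulus _; have al0 : 0 <= al := modulus_ge0 _.
move: al0; rewrite le_eqVlt => /predU1P[<-|al0].
  by apply: easy; rewrite of_real0 scale0r.
have pair : QGLC_pair xs (fun n => sign (xs n f)) A
    (of_real k al^-1 *: (f - proj A f)).
  have coord n : xs n (f - proj A f) = if n \in A then 0 else xs n f.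
    rewrite linearB /= (coord_proj biorth) //.
    by case: ifP => _; rewrite ?subrr ?subr0.
  split=> //; first by move=> n _; exact: modulus_sign.
    apply/seteqP; split=> // n []; rewrite /supp /= linearZ /= coord => + An.
    by rewrite mem_set // mulr0 eqxx.
  move=> n; rewrite coordZ coord modulus_of_real ?invr_ge0 ?(ltW al0) //.
  case: (boolP (n \in A)) => nA; first by rewrite modulus0 mulr0 ler01.
  rewrite mulrC ler_pdivrMr // mul1r gA // => An.
  by rewrite mem_set in nA.
have := hQ _ _ _ pair.
rewrite -[ind _ _ _](scalerK (_ : of_real k al != 0)) ?of_real_eq0 ?gt_eqF //.
have -> : (of_real k al)^-1 = of_real k al^-1.
  apply: (mulfI (_ : of_real k al != 0)); first by rewrite of_real_eq0 gt_eqF.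
  by rewrite -of_realM !divff ?of_real1 ?of_real_eq0 ?gt_eqF.
rewrite -scalerDr !qnZ_real ?invr_ge0 ?(ltW al0) //.
by rewrite mulrCA ler_pM2l ?invr_gt0 // [X in Q * qn X]addrC.
Qed.

End Truncation.

(** * Bounds for coordinates, projections and truncations *)

Section Bounds.
Context {R : realType} {k : scalar_kind} {X : lmodType (scalars R k)}.
Variables (qn : X -> R) (x : nat -> X) (xs : nat -> {scalar X}).
Hypothesis hq : is_quasi_norm qn.
Hypothesis biorth : forall n j, xs n (x j) = (n == j)%:R.
Local Notation proj := (Defs.proj x xs).
Local Notation trunc := (trunc x xs).

Lemma proj_supset A E c : finite_set A -> E `<=` A ->
  proj A (ind x c E) = ind x c E.
Proof.
move=> fA EA; have fE := sub_finite_set EA fA.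
transitivity (ind x (fun n => if n \in E then c n else 0) A).
  by apply: ind_eq => n _; rewrite (coord_ind biorth).
rewrite !(indE _ _ fA) // big_mkcond [RHS]big_mkcond; apply: eq_big_seq => n.
by rewrite in_fset_set // => ->; case: ifP; rewrite ?scale0r.
Qed.

Lemma proj_setD A B f : finite_set A -> B `<=` A ->
  proj (A `\` B) f = proj A f - proj B f.
Proof. exact: ind_setD. Qed.

Lemma qn_x_gt0 n : 0 < qn (x n).
Proof.
rewrite lt_neqAle (qn_ge0 hq) andbT; apply/eqP => /esym qx.
have [_ /(_ _ qx) x0 _ _] := hq.
have := biorth n n; rewrite x0 linear0 eqxx => /eqP.
by rewrite eq_sym oner_eq0.
Qed.

(** M-boundedness controls [qn (x n) * modulus (xs n f)], and semi-normalization keeps [qn (x n)]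
    away from zero, whence one [D] for all [n]. *)
Lemma coord_bounded : semi_normalized qn x -> M_bounded qn x xs ->
  exists2 D : R, 1 <= D & forall n f, modulus (xs n f) <= D * qn f.
Proof.
move=> [inf0 _] Mb.
have [c c0 hc] : exists2 c : R, 0 < c & forall n, c <= qn (x n).
  have lb n := @ereal_inf_lbound _ [set (qn (x n))%:E | n in [set: nat]]
    (qn (x n))%:E (ex_intro2 _ _ n I erefl).
  move: inf0 lb; case: ereal_inf => [r r0 lb|_ /(_ 0%N)//|//].
  by exists r => // n; rewrite -lee_fin.
have [M hM] : exists M : R, forall n f, qn f <= 1 ->
    qn (x n) * modulus (xs n f) <= M.
  have ub n := @ereal_sup_ubound _
    [set (qn (x n))%:E * dual_norm qn (xs n) | n in [set: nat]]%E _
    (ex_intro2 _ _ n I erefl).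
  have h n f : qn f <= 1 -> ((qn (x n) * modulus (xs n f))%:E <=
      (qn (x n))%:E * dual_norm qn (xs n))%E.
    move=> f1; rewrite EFinM; apply: lee_wpmul2l; first by rewrite lee_fin (qn_ge0 hq).
    by apply: ereal_sup_ubound; exists f.
  move: Mb ub; rewrite /M_bounded; case: ereal_sup => [r _ ub|//|_ ub].
    by exists r => n f /(h n) /le_trans/(_ (ub n)); rewrite lee_fin.
  exists 0 => n f /(h n) /le_trans/(_ (ub n)).
  by rewrite leeNy_eq.
exists (`|M| / c + 1) => [|n f].
  by rewrite lerDr divr_ge0 // ltW.
have [f0|f0] := eqVneq (qn f) 0.
  have [_ /(_ _ f0) -> _ _] := hq.
  by rewrite linear0 modulus0 (qn0 hq) mulr0.
have qf0 : 0 < qn f by rewrite lt_neqAle eq_sym f0 (qn_ge0 hq).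
have := hM n (of_real k (qn f)^-1 *: f).
rewrite qnZ_real ?invr_ge0 ?(ltW qf0) // mulVf // => /(_ (lexx _)).
rewrite coordZ modulus_of_real ?invr_ge0 ?(ltW qf0) // => h.
rewrite mulrC -ler_pdivrMl // (@le_trans _ _ (`|M| / c)) ?lerDl //.
rewrite ler_pdivlMr // mulrC; apply: le_trans (ler_norm M).
apply: le_trans h; rewrite ler_wpM2r // mulr_ge0 ?modulus_ge0 //.
by rewrite invr_ge0 ltW.
Qed.

(** [B] depends on [A], which is harmless: it only multiplies an approximation error that tends to
    zero while [A] stays fixed. *)
Lemma proj_bounded p K D A : 0 < p -> power_subadditive qn p K -> 0 <= K ->
  (forall n f, modulus (xs n f) <= D * qn f) -> 0 <= D -> finite_set A ->
  exists2 B, 0 <= B & forall f, qn (proj A f) `^ p <= B * qn f `^ p.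
Proof.
move=> p0 sub K0 hD D0 fA; pose r := enum_fset (fset_set A).
exists (K * \sum_(n <- r | n \in A) (D * qn (x n)) `^ p).
  by rewrite mulr_ge0 // sumr_ge0 // => n _; exact: powR_ge0.
move=> f; rewrite /Defs.proj -/(ind x (xs^~ f) A) (indE _ _ fA) //.
apply: (le_trans (qn_sum_le sub _ _ _)); rewrite -mulrA ler_wpM2l // mulr_suml.
apply: ler_sum => n _; rewrite -powRM ?mulr_ge0 ?(qn_ge0 hq) //.
apply: powR_monotone; rewrite ?(qn_ge0 hq) // qnZ // mulrAC.
by rewrite ler_wpM2r ?(qn_ge0 hq).
Qed.

(* On finitely supported vectors [g], the vector [g - proj A g] is itself the
   difference of two greedy projections, so the bound passes to [f] by density;
   raising [f] on [A] first keeps [A] greedy for the approximants. *)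
Lemma proj_compl_le p C D f A : 0 < p -> power_subadditive qn p 1 ->
  (forall f e, 0 < e -> exists2 g, linear_span x g & qn (f - g) < e) ->
  (forall n f, modulus (xs n f) <= D * qn f) -> 1 <= D ->
  qg_bound qn x xs C -> 0 < C -> finite_set A -> greedy_set xs f A ->
  qn (f - proj A f) <= C * qn f.
Proof.
move=> p0 sub dense hD D1 hC C0 fA gA.
have D0 : 0 < D by apply: lt_le_trans D1.
have [B B0 hB] := proj_bounded p0 sub ler01 hD (ltW D0) fA.
apply: (powR_le_inj p0); rewrite ?mulr_ge0 ?(qn_ge0 hq) ?(ltW C0) //.
pose s := sgn_sum x xs f A.
pose W := (C `^ p + 1 + B) * (qn s `^ p + 1).
apply: (@le_expr_lim _ (2^-1 `^ p) _ W) => [||n]; rewrite ?powR_ge0 //.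
  by apply: powR_lt1 => //; lra.
rewrite -powRX ?invr_ge0 //; set e := 2^-1 ^+ n.
have e0 : 0 < e by rewrite exprn_gt0 // invr_gt0.
(* This accuracy moves each coefficient by at most [e / 2], so two such errors do not exceed the gap
   [e]. *)
have d0 : 0 < e / (2 * D) by rewrite divr_gt0 // mulr_gt0.
have [g /linear_spanP[E [c [fE gE]]] hg] := dense (raise x xs f A e) _ d0.
have Dd : D * (e / (2 * D)) = e / 2 by field; rewrite gt_eqF.
have de : e / (2 * D) <= e.
  by rewrite ler_pdivrMr ?mulr_gt0 // ler_peMr // ?ltW //; lra.
have close j : modulus (xs j (raise x xs f A e - g)) <= e / 2.
  apply: le_trans (hD _ _) _; rewrite -Dd ler_pM2l //; exact: ltW.
have gA' : greedy_set xs g A.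
  move=> i j Ai Aj; have := raise_gap biorth fA e0 gA Ai Aj.
  have := close i; have := close j.
  have := modulus_subr_ge (xs i (raise x xs f A e)) (xs i g).
  have := modulus_subr_ge (xs j g) (xs j (raise x xs f A e)).
  rewrite -[xs j g - _]opprB modulusN -!linearB /=; lra.
(* The union of [E] and [A] contains the support of [g], hence is greedy; removing [A] from it
   projects [g] to [g - proj A g]. *)
have Pg : qn (g - proj A g) <= C * qn g.
  have fEA : finite_set (E `|` A) by rewrite finite_setU.
  have gP : proj (E `|` A) g = g by rewrite gE proj_supset //; exact: subsetUl.
  rewrite -{1}gP -proj_setD //.
  apply: hC => //.
  move=> i j _ Ej; rewrite gE (coord_ind biorth _ j) // memNset; last by move=> ?; apply: Ej; left.
  by rewrite modulus0 modulus_ge0.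
have fg : qn (f - g) `^ p <= e `^ p * (qn s `^ p + 1).
  have -> : f - g = of_real k (- e) *: s + (raise x xs f A e - g).
    by rewrite /raise -/s of_realN scaleNr addrA addrA [- _ + f]addrC subrK.
  apply: (le_trans (qnD_le sub _ _)); rewrite mul1r mulrDr mulr1 lerD //.
    by rewrite of_realN scaleNr qnN // qnZ_real ?(ltW e0) // powRM ?(qn_ge0 hq) ?(ltW e0).
  by apply: powR_monotone; rewrite ?(qn_ge0 hq) // (le_trans (ltW hg)).
have Pfg : qn ((f - g) - proj A (f - g)) `^ p <= (1 + B) * qn (f - g) `^ p.
  apply: (le_trans (qnD_le sub _ _)); rewrite mul1r mulrDl mul1r lerD2l qnN //.
have -> : f - proj A f = (g - proj A g) + ((f - g) - proj A (f - g)).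
  rewrite (projB x xs _ _ fA); set u := proj A f; set v := proj A g.
  by rewrite opprB addrACA [g + _]addrC subrK addKr.
apply: (le_trans (qnD_le sub _ _)); rewrite mul1r.
have gf : qn g `^ p <= qn f `^ p + qn (f - g) `^ p.
  by have := qnD_le sub f (g - f); rewrite mul1r addrC subrK qnB.
have := powR_monotone p0 (qn_ge0 hq _) Pg.
rewrite !powRM ?(qn_ge0 hq) ?(ltW C0) // => h.
have Cp : 0 <= C `^ p := powR_ge0 _ _.
have := ler_wpM2l Cp gf.
have : (C `^ p + 1 + B) * qn (f - g) `^ p <= e `^ p * W.
  by rewrite /W mulrCA ler_wpM2l // !addr_ge0.
by lra.
Qed.

(** Normalizing by [qn f + e], with [e] tending to zero, also covers [qn f = 0]. *)
Lemma trunc_homogeneous L f A : finite_set A -> 0 <= L ->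
  (forall r, 0 < r -> qn (of_real k r *: f) <= 1 ->
    qn (trunc (of_real k r *: f) A) <= L) ->
  qn (trunc f A) <= L * qn f.
Proof.
move=> fA L0 h; apply: (@le_expr_lim _ 2^-1 _ L) => [||n]; [lra|lra|].
set e := 2^-1 ^+ n; have e0 : 0 < e by rewrite exprn_gt0 // invr_gt0.
have c0 : 0 < qn f + e by rewrite ltr_wpDl ?(qn_ge0 hq).
have := h (qn f + e)^-1; rewrite invr_gt0 => /(_ c0).
rewrite truncZ ?invr_gt0 // !qnZ_real ?invr_ge0 ?(ltW c0) //.
rewrite ![(_ + _)^-1 * _]mulrC !ler_pdivrMr // mul1r lerDl ltW // => /(_ isT).
by rewrite mulrDr [e * L]mulrC.
Qed.

(** Once [f] is raised by [e], the set [A] is its [m]-th greedy set for some [m], also after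
    rescaling, so the bound on [mth_trunc] applies; then [e] tends to zero. *)
Lemma trunc_le_of_mth L kap f A :
  (forall f g, qn (f + g) <= kap * (qn f + qn g)) -> 0 <= kap ->
  (forall m g, qn g <= 1 -> qn (mth_trunc x xs m g) <= L) ->
  finite_set A -> greedy_set xs f A ->
  qn (trunc f A) <= kap ^+ 2 * L * qn f.
Proof.
move=> tri kap0 hL fA gA.
have L0 : 0 <= L.
  by apply: le_trans (hL 0%N 0 _); rewrite ?(qn_ge0 hq) ?(qn0 hq).
pose s := sgn_sum x xs f A.
pose W := kap * (L * (kap * qn s) + qn s).
apply: (@le_expr_lim _ 2^-1 _ W) => [||n]; [lra|lra|].
set e := 2^-1 ^+ n; have e0 : 0 < e by rewrite exprn_gt0 // invr_gt0.
have hT : qn (trunc (raise x xs f A e) A) <= L * qn (raise x xs f A e).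
  apply: trunc_homogeneous => // r r0 hr.
  have [m hm] := mth_greedy_set_raise biorth fA e0 gA.
  by have := hL m _ hr; rewrite /mth_trunc (mth_greedy_setE (mth_greedy_setZ r0 hm)).
have hr : qn (raise x xs f A e) <= kap * (qn f + e * qn s).
  by apply: (le_trans (tri _ _)); rewrite qnZ_real ?(ltW e0).
have := tri (trunc (raise x xs f A e) A) (- (of_real k e *: s)).
rewrite {1}trunc_raise // addrK qnN // qnZ_real ?(ltW e0) //.
have := ler_wpM2l kap0 hT; have := ler_wpM2l (mulr_ge0 kap0 L0) hr.
rewrite /W expr2; lra.
Qed.

Lemma qg_bound_of_quasi_greedy : quasi_greedy qn x xs ->
  exists2 C, 0 < C & qg_bound qn x xs C.
Proof.
move=> [C hC]; have [_ _ _ [kap kap1 tri]] := hq.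
exists (2 * kap * `|C| + 1) => [|f A B fA gA gB BA].
  by rewrite ltr_wpDl // !mulr_ge0 // (le_trans ler01).
have fB := sub_finite_set BA fA.
rewrite proj_setD //; apply: (le_trans (tri _ _)); rewrite qnN //.
have le_norm : C * qn f <= `|C| * qn f by rewrite ler_wpM2r ?(qn_ge0 hq) ?ler_norm.
have := le_trans (hC _ _ fA gA) le_norm; have := le_trans (hC _ _ fB gB) le_norm.
move=> hb ha; have := qn_ge0 hq f; have kap0 : 0 <= kap by lra.
by have := ler_wpM2l kap0 (lerD ha hb); lra.
Qed.

Lemma trunc_le_of_qg_bound C : 0 < C -> qg_bound qn x xs C ->
  exists2 L, 0 <= L &
    forall f A, finite_set A -> greedy_set xs f A -> qn (trunc f A) <= L * qn f.
Proof.
move=> C0 hC; have [p [K [p0 K1 sub]]] := quasi_norm_power_subadditive hq.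
have K0 : 0 < K by apply: lt_le_trans K1.
have [_ _ _ [kap kap1 tri]] := hq; have kap0 : 0 <= kap by lra.
(* With this [t] the error absorbed by the left-hand side is exactly one half of it. *)
pose t := ((2 * K ^+ 2)^-1) `^ p^-1.
have t0 : 0 < t by rewrite powR_gt0 // invr_gt0 mulr_gt0 // exprn_gt0.
have tp : 1 - K ^+ 2 * t `^ p = 2^-1.
  rewrite /t powRVK ?gt_eqF ?invr_ge0 ?mulr_ge0 ?exprn_ge0 ?(ltW K0) //.
  by field; rewrite gt_eqF.
set G := 1 - (1 + (A_const p)^-1 * C^-1 * t) `^ (- p).
have G0 : 0 < G by exact: eta_term_gt0.
pose Z := 2 * K ^+ 2 / G.
have Z0 : 0 <= Z by rewrite divr_ge0 ?mulr_ge0 ?exprn_ge0 ?(ltW K0) ?(ltW G0).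
pose H := Z `^ p^-1 * C.
have H0 : 0 <= H by rewrite mulr_ge0 ?powR_ge0 ?ltW.
have hU f A : finite_set A -> greedy_set xs f A ->
    qn (restricted_trunc x xs f A) <= H * qn f.
  move=> fA gA; apply: (powR_le_inj p0); first exact: qn_ge0.
    by rewrite mulr_ge0 ?(qn_ge0 hq).
  have := restricted_trunc_le hq biorth p0 K1 sub C0 hC t0 fA gA.
  rewrite tp -/G -ler_pdivlMr // -ler_pdivlMr ?invr_gt0 // => h.
  apply: (le_trans h); rewrite /H -[_ * C * _]mulrA.
  rewrite [in leRHS]powRM ?mulr_ge0 ?(qn_ge0 hq) ?powR_ge0 ?(ltW C0) //.
  rewrite powRVK ?gt_eqF // invrK /Z.
  by rewrite le_eqVlt; apply/orP; left; apply/eqP; field; rewrite gt_eqF.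
exists (kap * (H + kap * (1 + C))).
  by rewrite mulr_ge0 // addr_ge0 // mulr_ge0 // addr_ge0 // ltW.
move=> f A fA gA; rewrite truncE //.
apply: (le_trans (tri _ _)); rewrite -mulrA ler_wpM2l // mulrDl lerD ?hU //.
apply: (le_trans (tri _ _)); rewrite -mulrA ler_wpM2l // mulrDl mul1r lerD2l qnN //.
exact: qg_bound0.
Qed.

End Bounds.

(** A finite infimum of admissible constants is admissible: for [w > 0] the quotient [v / w] is a
    lower bound of [S], and for [w = 0] any member of [S] gives the claim. *)
Lemma ereal_inf_EFin_le (R : realType) (S : set R) (Q v w : R) :
  ereal_inf [set C%:E | C in S] = Q%:E -> 0 <= w ->
  (forall C, S C -> v <= C * w) -> v <= Q * w.
Proof.
move=> hQ w0 h; have [C SC] : exists C, S C.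
  apply: contrapT => /forallNP S0; move: hQ; suff -> : [set C%:E | C in S] = set0.
    by rewrite ereal_inf0.
  by apply/seteqP; split=> // y [C SC _]; case: (S0 C).
move: w0; rewrite le_eqVlt => /predU1P[w0|w0].
  by have := h C SC; rewrite -w0 !mulr0.
rewrite -ler_pdivrMr // -lee_fin -hQ; apply/ereal_infP => _ [C' SC' <-].
by rewrite lee_fin ler_pdivrMr // h.
Qed.

(** Makes [fine] faithful: a member of [S] bounds the infimum from above, and the lower bound 1
    excludes [-oo]. *)
Lemma ereal_inf_EFin_fine (R : realType) (S : set R) (C : R) :
  S C -> lbound S 1 ->
  ereal_inf [set c%:E | c in S] = (fine (ereal_inf [set c%:E | c in S]))%:E /\
  1 <= fine (ereal_inf [set c%:E | c in S]).
Proof.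
move=> SC S1.
have h1 : (1%:E <= ereal_inf [set c%:E | c in S])%E.
  by apply/ereal_infP => _ [c Sc <-]; rewrite lee_fin S1.
have h2 : (ereal_inf [set c%:E | c in S] <= C%:E)%E.
  by apply: ereal_inf_lbound; exists C.
by move: h1 h2; case: ereal_inf => [r|//|//]; rewrite lee_fin.
Qed.

Lemma lty_EFin_bound (R : realType) (y : \bar R) : (y < +oo)%E ->
  exists L : R, (y <= L%:E)%E.
Proof. by case: y => [r _|//|_]; [exists r|exists 0; rewrite leNye]. Qed.

(** * The equivalence and the two estimates of constants *)

Section Main.
Context {R : realType} {k : scalar_kind} {X : lmodType (scalars R k)}.
Variables (qn : X -> R) (x : nat -> X) (xs : nat -> {scalar X}).
Hypothesis hq : is_quasi_norm qn.
Hypothesis hb : is_basis qn x xs.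
Hypothesis hs : semi_normalized qn x.
Hypothesis hM : M_bounded qn x xs.
Let biorth : forall n j, xs n (x j) = (n == j)%:R.
Proof. by case: hb. Qed.
Let dense : forall f e, 0 < e -> exists2 g, linear_span x g & qn (f - g) < e.
Proof. by case: hb. Qed.
Local Notation proj := (Defs.proj x xs).
Local Notation trunc := (trunc x xs).

(** Tested on [x 0] and the singleton of 0, whose projection fixes [x 0]. *)
Lemma qg_bound_ge1 C : qg_bound qn x xs C -> 1 <= C.
Proof.
move=> hC; have q0 := qn_x_gt0 hq biorth 0.
have x0E : ind x (fun=> 1) [set 0%N] = x 0%N by rewrite /ind fsbig_set1 scale1r.
have := qg_bound0 hC (finite_set1 0%N) (greedy_ind biorth (fun=> 1) (finite_set1 _)).
by rewrite (proj_ind biorth) // x0E -[leLHS]mul1r ler_pM2r.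
Qed.

Lemma QGLC_pair0 eps : QGLC_pair xs eps set0 (x 0%N).
Proof.
split=> //; first exact: setI0.
by move=> n; rewrite biorth; case: eqP => _; rewrite ?modulus1 ?modulus0 ?ler01.
Qed.

Lemma ql_bound_ge1 C : (forall eps A f, QGLC_pair xs eps A f ->
  Num.max (qn f) (qn (ind x eps A)) <= C * qn (f + ind x eps A)) -> 1 <= C.
Proof.
have q0 := qn_x_gt0 hq biorth 0.
move=> /(_ _ _ _ (QGLC_pair0 (fun=> 1))); rewrite ind0 addr0 ge_max => /andP[+ _].
by rewrite -[leLHS]mul1r ler_pM2r.
Qed.

Lemma greedy_infinite_trunc f A : ~ finite_set A -> trunc f A = 0.
Proof. by move=> iA; rewrite /Defs.trunc asboolF. Qed.

(** The normalized [x 0] with the empty greedy set gives the value 1; positivity of [Lambda_t] then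
    settles products with [+oo]. *)
Lemma Lambda_t_ge1 : (1%:E <= Lambda_t qn x xs)%E.
Proof.
have q0 := qn_x_gt0 hq biorth 0.
apply: ereal_sup_ubound.
exists (of_real k (qn (x 0%N))^-1 *: x 0%N), set0.
rewrite truncE // restricted_trunc0 add0r /Defs.proj fsbig_set0 subr0.
rewrite qnZ_real ?invr_ge0 ?(ltW q0) // mulVf ?gt_eqF //.
by split=> //.
Qed.

Lemma quasi_greedy_iff : quasi_greedy qn x xs <->
  QGLC qn x xs /\ mth_trunc_uniformly_bounded qn x xs.
Proof.
have [_ _ _ [kap kap1 tri]] := hq; have kap0 : 0 <= kap by lra.
split=> [qg|[[C hC] mtb]].
  split.
    (* [A] is a greedy set of [f + ind x eps A] and projects it to [ind x eps A], so the same [C]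
       works. *)
    have [C hC] := qg; exists C => eps A f [fA e1 /seteqP[sfA _] f1].
    have coord n : xs n (f + ind x eps A) = if n \in A then eps n else xs n f.
      rewrite linearD /= (coord_ind biorth) //.
      case: (boolP (n \in A)) => [/set_mem An|_]; last by rewrite addr0.
      have [->|fn] := eqVneq (xs n f) 0; first by rewrite add0r.
      by have := sfA n (conj fn An).
    have -> : ind x eps A = proj A (f + ind x eps A).
      by apply: ind_eq => n nA; rewrite coord nA.
    rewrite {2}(_ : proj A (f + ind x eps A) = ind x eps A); last first.
      by apply: ind_eq => n nA; rewrite coord nA.
    apply: hC => // n j An Aj.
    by rewrite !coord (mem_set An) memNset // e1.
  have [C C0 hC] := qg_bound_of_quasi_greedy hq qg.
  have [L L0 hL] := trunc_le_of_qg_bound hq biorth C0 hC.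
  apply: (@le_lt_trans _ _ L%:E); last exact: ltry.
  apply: ge_ereal_sup => _ [m _ <-]; apply: ge_ereal_sup => _ [f f1 <-].
  rewrite lee_fin; have [fA gA] := mth_greedy_set_greedy xs f m.
  by apply: (le_trans (hL _ _ fA gA)); rewrite ler_piMr.
have [L hL] := lty_EFin_bound mtb.
have hmL m g : qn g <= 1 -> qn (mth_trunc x xs m g) <= L.
  move=> g1; rewrite -lee_fin; apply: le_trans hL.
  apply: le_trans (ereal_sup_ubound _); last by exists m.
  by apply: ereal_sup_ubound; exists g.
(* [Q] bounds [g] as the difference of [g + ind x eps B] and [ind x eps B]. *)
pose Q := kap * (1 + `|C|).
have Q1 : 1 <= Q by have := normr_ge0 C; rewrite /Q; nra.
have hQ eps B g : QGLC_pair xs eps B g -> qn g <= Q * qn (g + ind x eps B).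
  move=> /hC h; have := tri (g + ind x eps B) (- ind x eps B).
  rewrite addrK qnN // => /le_trans; apply.
  rewrite /Q -mulrA ler_wpM2l // mulrDl mul1r lerD2l (le_trans h) //.
  by rewrite ler_wpM2r ?(qn_ge0 hq) ?ler_norm.
exists (kap * (1 + Q * (kap ^+ 2 * L))) => f A fA gA.
have hT := trunc_le_of_mth hq biorth tri kap0 hmL fA gA.
have hP := proj_compl_le_trunc hq biorth hQ Q1 fA gA.
have := tri f (- (f - proj A f)); rewrite subKr qnN // => /le_trans; apply.
rewrite -mulrA ler_wpM2l // mulrDl mul1r lerD2l (le_trans hP) //.
by rewrite -mulrA ler_wpM2l //; lra.
Qed.

Lemma Lambda_t_le p : 0 < p ->
  (forall f g, qn (f + g) `^ p <= qn f `^ p + qn g `^ p) ->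
  quasi_greedy qn x xs -> forall C, C = fine (C_qg qn x xs) ->
  (Lambda_t qn x xs <= (C * (1 + C `^ p * eta p C `^ p) `^ p^-1)%:E)%E.
Proof.
move=> p0 hp qg C EC0; have sub := power_subadditive1 hq p0 hp.
have [C' _ hC'] := qg_bound_of_quasi_greedy hq qg.
have [EC C1] := @ereal_inf_EFin_fine _ [set C | qg_bound qn x xs C] C' hC'
  (fun C => @qg_bound_ge1 C).
rewrite -/(C_qg qn x xs) -EC0 in EC C1; have C0 : 0 < C by lra.
have hC : qg_bound qn x xs C.
  move=> f A B fA gA gB BA; apply: (ereal_inf_EFin_le EC); first exact: qn_ge0.
  by move=> c; exact.
have [D D1 hD] := coord_bounded hq hs hM.
have eta0 : 0 <= eta p C.
  apply: lb_le_inf; last by move=> _ [t _ <-]; rewrite mulr_ge0 ?powR_ge0.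
  by eexists; exists 2^-1 => //=; apply/andP; split; lra.
apply: ge_ereal_sup => _ [f [A [f1 gA ->]]]; rewrite lee_fin.
have [fA|iA] := pselect (finite_set A); last first.
  by rewrite greedy_infinite_trunc // qn0 // mulr_ge0 ?powR_ge0 ?ltW.
(* The quotient by [C] is at most each value whose infimum defines [eta], one value for every
   [t]. *)
have hU : qn (restricted_trunc x xs f A) <= C * eta p C.
  rewrite mulrC -ler_pdivrMr //; apply: lb_le_inf.
    by eexists; exists 2^-1 => //=; apply/andP; split; lra.
  move=> _ [t /andP[t0 t1] <-]; rewrite ler_pdivrMr //.
  set G := 1 - (1 + _) `^ _.
  have := restricted_trunc_le hq biorth p0 (lexx 1) sub C0 hC t0 fA gA.
  have T0 : 0 < 1 - t `^ p by rewrite subr_gt0 powR_lt1 // ltW.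
  have G0 : 0 < G by exact: eta_term_gt0.
  rewrite -/G expr1n !mul1r => h.
  apply: (le_mul_roots p0); rewrite ?(qn_ge0 hq) ?(ltW C0) //; apply: (le_trans h).
  by apply: powR_monotone; rewrite ?mulr_ge0 ?(qn_ge0 hq) ?(ltW C0) // ler_piMr ?(ltW C0).
have hP := proj_compl_le hq biorth p0 sub dense hD D1 hC C0 fA gA.
have hP1 : qn (f - proj A f) <= C by apply: (le_trans hP); rewrite ler_piMr ?(ltW C0).
apply: (powR_le_inj p0); rewrite ?qn_ge0 ?mulr_ge0 ?powR_ge0 ?(ltW C0) //.
have S0 : 0 <= 1 + C `^ p * eta p C `^ p by rewrite addr_ge0 ?mulr_ge0 ?powR_ge0.
rewrite powRM ?powR_ge0 ?(ltW C0) // powRVK ?gt_eqF // truncE //.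
apply: (le_trans (hp _ _)).
have h1 := powR_monotone p0 (qn_ge0 hq _) hU.
have h2 := powR_monotone p0 (qn_ge0 hq _) hP1.
rewrite powRM ?(ltW C0) // in h1.
(* Because this power is at least 1, the sum of the two bounds fits into the stated product. *)
have Cp1 : 1 <= C `^ p by have := powR_monotone p0 ler01 C1; rewrite powR1.
have e0 : 0 <= C `^ p * eta p C `^ p by rewrite mulr_ge0 ?powR_ge0.
have := ler_wpM2r e0 Cp1; rewrite mul1r mulrDr mulr1; lra.
Qed.

Lemma C_qg_le p : 0 < p ->
  (forall f g, qn (f + g) `^ p <= qn f `^ p + qn g `^ p) ->
  (C_qg qn x xs <= (2 `^ p^-1)%:E * C_ql qn x xs * Lambda_t qn x xs)%E.
Proof.
move=> p0 hp; have L1 := Lambda_t_ge1.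
have two0 : 0 < 2 `^ p^-1 :> R by rewrite powR_gt0.
have Q1 : (1%:E <= C_ql qn x xs)%E.
  by apply/ereal_infP => _ [C hC <-]; rewrite lee_fin ql_bound_ge1.
(* If [C_ql] or [Lambda_t] is infinite, the right-hand side is [+oo]: all its factors are
   positive. *)
case EQ : (C_ql qn x xs) Q1 => [Q| |//] Q1; last first.
  rewrite gt0_muley ?lte_fin // gt0_mulye ?leey //.
  exact: lt_le_trans L1.
case EL : (Lambda_t qn x xs) L1 => [L| |//] L1; last first.
  rewrite gt0_muley ?leey // -EFinM lte_fin mulr_gt0 //.
  by rewrite lee_fin in Q1; lra.
rewrite !lee_fin in Q1 L1.
rewrite -!EFinM; apply: ereal_inf_lbound; eexists; last reflexivity.
move=> f A B fA gA gB BA; have fB := sub_finite_set BA fA.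
have hQ eps E g : QGLC_pair xs eps E g -> qn g <= Q * qn (g + ind x eps E).
  move=> pr; apply: (ereal_inf_EFin_le EQ); first exact: qn_ge0.
  by move=> C /(_ _ _ _ pr); rewrite ge_max => /andP[].
have hT E : finite_set E -> greedy_set xs f E -> qn (trunc f E) <= L * qn f.
  move=> fE gE; apply: trunc_homogeneous => //; first lra.
  move=> r r0 h; rewrite -lee_fin -EL; apply: ereal_sup_ubound.
  by eexists _, E; split; [exact: h|exact: greedy_setZ|].
have hP E : finite_set E -> greedy_set xs f E -> qn (f - proj E f) <= Q * (L * qn f).
  move=> fE gE; apply: (le_trans (proj_compl_le_trunc hq biorth hQ Q1 fE gE)).
  by rewrite ler_wpM2l ?hT //; lra.
have QL0 : 0 <= Q * (L * qn f) by rewrite !mulr_ge0 ?(qn_ge0 hq) //; lra.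
apply: (powR_le_inj p0); rewrite ?(qn_ge0 hq) //.
  by rewrite -!mulrA mulr_ge0 // ltW.
rewrite -!mulrA powRM ?(ltW two0) // powRVK ?gt_eqF //.
(* Both complements are bounded by [Q * (L * qn f)]; adding their [p]-th powers produces the 2 whose
   root appears in the bound. *)
have -> : proj (A `\` B) f = (f - proj B f) - (f - proj A f).
  by rewrite proj_setD // opprB [RHS]addrC subrKA.
apply: (le_trans (hp _ _)); rewrite qnN //.
rewrite [leRHS]mulr_natl mulr2n; apply: lerD.
  exact: powR_monotone p0 (qn_ge0 hq _) (hP B fB gB).
exact: powR_monotone p0 (qn_ge0 hq _) (hP A fA gA).
Qed.

End Main.

Theorem proposition3p14 (R : realType) (k : scalar_kind)
    (X : lmodType (scalars R k)) (qn : X -> R)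
    (x : nat -> X) (xs : nat -> {scalar X}) :
  quasi_Banach qn ->
  is_basis qn x xs ->
  semi_normalized qn x ->
  M_bounded qn x xs ->
  (quasi_greedy qn x xs <->
     QGLC qn x xs /\ mth_trunc_uniformly_bounded qn x xs) /\
  (forall p : R, 0 < p -> p <= 1 -> p_Banach qn p ->
     (quasi_greedy qn x xs ->
        let C := fine (C_qg qn x xs) in
        (Lambda_t qn x xs <=
           (C * (1 + C `^ p * eta p C `^ p) `^ p^-1)%:E)%E) /\
     (C_qg qn x xs <=
        (2 `^ p^-1)%:E * C_ql qn x xs * Lambda_t qn x xs)%E).
Proof.
move=> [hq _] hb hs hM; split; first exact: quasi_greedy_iff.
move=> p p0 _ [_ hp]; split; last exact: C_qg_le.
by move=> qg; exact: Lambda_t_le.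
Qed.
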